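(* Let $A,B\in\mathbb{M}_{m\times n}(\mathbb{C})$ with $A\neq 0$, let $2\leq p<\infty$, $1\le k\le n_0=\min\{m,n\}$, and $\varepsilon\in[0,1)$. Then $A\perp^{\varepsilon}_{\|\cdot\|_{(p,k)}}B$ if and only if there exist $k$ orthonormal vectors $v_1,\ldots,v_k\in\mathbb{C}^n$ satisfying $A^*Av_i=\sigma_i^2(A)v_i$ for all $1\leq i\leq k$, and there exists $z_0\in\mathbb{C}$ with $|z_0|\leq1$, such that $$\frac{1}{\|A\|_{(p,k)}^{p-1}}\sum_{i=1}^{k}\big\langle (A^*A)^{\frac{p-2}{2}}A^*Bv_i,v_i\big\rangle+z_0\,\varepsilon\,\|B\|_{(p,k)}=0.$$
   Context: $\mathbb{M}_{m\times n}(\mathbb{C})$ is the space of complex $m\times n$ matrices, $n_0=\min\{m,n\}$, and $\sigma_1(A)\ge\cdots\ge\sigma_{n_0}(A)$ are the singular values of $A$. For $1\le p<\infty$ and $1\le k\le n_0$ the Ky Fan $p$-$k$ norm is $\|A\|_{(p,k)}=(\sigma_1^p(A)+\cdots+\sigma_k^p(A))^{1/p}$. For a norm $\|\cdot\|$ and $\varepsilon\in[0,1)$, $A$ is $\varepsilon$-Birkhoff orthogonal to $B$, written $A\perp^{\varepsilon}_{\|\cdot\|}B$, if $\|A+\lambda B\|^2\geq\|A\|^2-2\varepsilon\|A\|\,\|\lambda B\|$ for all $\lambda\in\mathbb{C}$. $\langle\cdot,\cdot\rangle$ is the standard inner product on $\mathbb{C}^n$. For $p=2$, $(A^*A)^{0}$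 is the identity matrix. *)

(* Defs.v *)
From HB Require Import structures.
From mathcomp Require Import all_boot all_order all_algebra.
From mathcomp Require Import complex.
From mathcomp Require Import reals exp.

Set Implicit Arguments.
Unset Strict Implicit.
Unset Printing Implicit Defensive.

Import Order.TTheory GRing.Theory Num.Theory.
Local Open Scope ring_scope.
Local Open Scope complex_scope.
Local Open Scope sesquilinear_scope.

(* Linear in the first argument, conjugate-linear in the second. *)
Definition inner (R : realType) (n : nat) (x y : 'cV[R[i]]_n) : R[i] :=
  (y ^t* *m x) 0 0.

Definition gram (R : realType) (m n : nat) (A : 'M[R[i]]_(m, n)) : 'M[R[i]]_n :=
  A ^t* *m A.

(* All n square roots of the eigenvalues of A^*A, in nonincreasing order and
   with multiplicity.  The entries of spectral_diag are real and nonnegative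
   for a positive semidefinite matrix, so Re loses nothing. *)
Definition singular_values (R : realType) (m n : nat) (A : 'M[R[i]]_(m, n)) :
    seq R :=
  sort (fun x y : R => y <= x)
    [seq Num.sqrt (complex.Re (spectral_diag (gram A) 0 j)) | j : 'I_n].

(* Indices start at 0: the i-th singular value, 1 <= i <= minn m n, is
   sigma A (i - 1). *)
Definition sigma (R : realType) (m n : nat) (A : 'M[R[i]]_(m, n)) (i : nat) :
    R :=
  nth 0 (singular_values A) i.

Definition kyfan (R : realType) (m n : nat) (p : R) (k : nat)
    (A : 'M[R[i]]_(m, n)) : R :=
  (\sum_(i < k) sigma A i `^ p) `^ p^-1.

Definition birkhoff_eps (R : realType) (m n : nat) (N : 'M[R[i]]_(m, n) -> R)
    (eps : R) (A B : 'M[R[i]]_(m, n)) : Prop :=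
  forall lam : R[i],
    N A ^+ 2 - 2 * eps * N A * N (lam *: B) <= N (A + lam *: B) ^+ 2.

(* Real power of a positive semidefinite matrix through its unitary
   diagonalization H = P^-1 D P.  Since 0 `^ 0 = 1 and 0 `^ s = 0 for s != 0,
   psd_pow H 0 is the identity matrix even when H is singular. *)
Definition psd_pow (R : realType) (n : nat) (H : 'M[R[i]]_n) (s : R) :
    'M[R[i]]_n :=
  invmx (spectralmx H)
    *m diag_mx (map_mx (fun z : R[i] => (complex.Re z `^ s)%:C)
                  (spectral_diag H))
    *m spectralmx H.

Definition orthonormal_family (R : realType) (n k : nat)
    (v : 'I_k -> 'cV[R[i]]_n) : Prop :=
  forall i j : 'I_k, inner (v i) (v j) = (i == j)%:R.

(* Main.v *)
(** Every X satisfies sum_i |X v_i|^p <= ||X||^p for orthonormal v_1, ..., v_k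
    (Jensen and Ky Fan), with equality at right singular vectors.  Hence, when
    the v_i are right singular vectors of A, Hoelder's inequality shows that
    X |-> sum_i sigma_i^(p-2) <X v_i, A v_i> is bounded by ||A||^(p-1) ||X||,
    with equality at X = A; this gives the "if" part by evaluating at
    A + lambda B.

    Conversely, let W be the set of values at X = B of these functionals.
    For |u| = 1, perturb A to A + t u B, take its right singular vectors and let
    t tend to 0 along an ultrafilter: the limits are right singular vectors
    of A and produce w in W with Re(u w) >= - eps ||A||^(p-1) ||B||.  Moreover W is
    compact, and it is convex, being a k-numerical range.  So its
    point nearest to 0 has modulus at most eps ||A||^(p-1) ||B||. *)

Require Import Defs.
From mathcomp Require Import all_boot all_order all_algebra.
From mathcomp Require Import perm complex.
From mathcomp Require Import boolp classical_sets filter reals topology normedtype sequences exp.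
From mathcomp Require Import ring lra.

Set Implicit Arguments.
Unset Strict Implicit.
Unset Printing Implicit Defensive.

Import Order.TTheory GRing.Theory Num.Theory.
Import numFieldNormedType.Exports.
Local Open Scope ring_scope.
Local Open Scope complex_scope.
Local Open Scope sesquilinear_scope.

(** * Powers and entrywise limits *)

(** The norm need not be differentiable at A, for instance when sigma_k = sigma_(k+1) > 0, so no
    derivative of it is taken: one-sided bounds come from testing Ky Fan's inequality on suitable
    isometries, followed by a limit. Since p >= 2, lengths enter through their squares with exponent
    p/2 >= 1, which gives convexity, while the exponent (p-2)/2 of the derivative is nonnegative, so
    that powers still pass to the limit at vanishing singular values.

    Right singular vectors cannot be followed continuously as t tends to 0. Along an ultrafilter any
    bounded choice of them converges, and convergence of the singular values comes out of Ky Fan's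
    inequality at the same time.

    The isometries V that define W are constrained by A^*A V = V S, where S is the diagonal of the
    ordered sigma_i^2. A mixture of V and V' must satisfy the same constraint. What makes this
    possible is that the overlap V'^* V commutes with S, hence has a singular value decomposition
    adapted to S. *)

Lemma powR_tangent (R : realType) (q a b : R) : 1 <= q -> 0 <= a -> 0 <= b ->
  a `^ q + q * a `^ (q - 1) * (b - a) <= b `^ q.
Proof.
move=> q1 a0 b0; have q0 : 0 < q by lra.
have [->|qn1] := eqVneq q 1.
  by rewrite subrr powRr0 !powRr1//; lra.
have q1' : 0 < q - 1 by rewrite subr_gt0 lt_neqAle eq_sym qn1.
move: a0; rewrite le_eqVlt => /predU1P[<-|a0].
  by rewrite !powR0 ?(gt_eqF q0) ?(gt_eqF q1')// mulr0 mul0r add0r powR_ge0.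
have Ea : a `^ q = a `^ (q - 1) * a.
  rewrite -{3}(powRr1 (ltW a0)) -powRD ?subrK//.
  by rewrite (gt_eqF q0).
(* Young's inequality for b/a and 1 with exponents q and q/(q-1); multiplied by q a^q it is the
   tangent inequality at a. *)
have := @conjugate_powR R (b / a) 1 q (q / (q - 1)) _ ler01 q0 _ _.
rewrite mulr1 powR1 => /(_ (divr_ge0 b0 (ltW a0)) (divr_gt0 q0 q1')).
rewrite powRM ?invr_ge0 ?(ltW a0)// -[in (a^-1) `^ q]powR_inv1 ?(ltW a0)//.
rewrite -powRrM mulN1r powRN => h.
have Aq : 0 < a `^ q by apply: powR_gt0.
have {h}: b / a <= b `^ q / a `^ q / q + 1 / (q / (q - 1)).
  by apply: h; field; rewrite gt_eqF ?gt_eqF.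
rewrite -(ler_pM2l q0) -(ler_pM2l Aq).
have -> : a `^ q * (q * (b / a)) = q * a `^ (q - 1) * b.
  by rewrite Ea; field; rewrite gt_eqF.
have -> : a `^ q * (q * (b `^ q / a `^ q / q + 1 / (q / (q - 1)))) =
   b `^ q + q * a `^ q - a `^ q.
  by field; rewrite !gt_eqF.
have -> : q * a `^ q = q * a `^ (q - 1) * a by rewrite Ea mulrA.
lra.
Qed.

(** The limit may be 0, as it is for a singular A. The formula through exp and ln fails there, and
    the tolerance e is pulled back to e^(1/r) instead. For r = 0 the power is constantly 1, even at
    base 0. *)
Lemma cvg_powR (R : realType) (F : set_system nat) (FF : ProperFilter F)
    (f : nat -> R) (l r : R) : 0 <= r -> (forall t, 0 <= f t) ->
  (f t @[t --> F] --> l)%classic -> (f t `^ r @[t --> F] --> l `^ r)%classic.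
Proof.
rewrite le_eqVlt => /predU1P[<- _ _|r0 f0 fl].
  by under eq_fun do rewrite powRr0; rewrite powRr0; apply: cvg_cst.
have l0 : 0 <= l.
  apply: (@ler_cvg_to _ F _ R (fun=> 0) f); [exact: cvg_cst|exact: fl|].
  exact: nearW.
move: l0; rewrite le_eqVlt => /predU1P[l0|l0].
  rewrite -l0 powR0 ?gt_eqF//; apply/cvgrPdist_lt => e e0.
  have: 0 < e `^ r^-1 by apply: powR_gt0.
  move/cvgrPdist_lt : fl => /[apply]; apply: filterS => t.
  rewrite -l0 !sub0r !normrN (ger0_norm (f0 _)) (ger0_norm (powR_ge0 _ _)) => ft.
  have -> : e = (e `^ r^-1) `^ r.
    by rewrite -powRrM mulVf ?gt_eqF// powRr1// ltW.
  by apply: gt0_ltr_powR => //; rewrite nnegrE ?powR_ge0.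
have pos : \forall t \near F, 0 < f t by apply: cvgr_gt fl _ l0.
have L : (expR (r * ln (f t)) @[t --> F] --> expR (r * ln l))%classic.
  apply: continuous_cvg; first exact: continuous_expR.
  apply: cvgMr; apply: continuous_cvg => //; exact: continuous_ln.
rewrite {2}/powR gt_eqF//; apply: cvg_trans L; apply: near_eq_cvg.
by near=> t; rewrite /powR gt_eqF//; near: t.
Unshelve. all: by end_near.
Qed.

Section Limits.
Variables (R : realType) (F : set_system nat).
Hypothesis FF : ProperFilter F.
Local Open Scope classical_set_scope.

(** Componentwise, so that only limits of real sequences have to be handled. *)
Definition ccvg (z : nat -> R[i]) (l : R[i]) : Prop :=
  complex.Re (z t) @[t --> F] --> complex.Re l /\
  complex.Im (z t) @[t --> F] --> complex.Im l.

Definition mxcvg (m n : nat) (M : nat -> 'M[R[i]]_(m, n)) (L : 'M_(m, n)) : Prop :=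
  forall i j, ccvg (fun t => M t i j) (L i j).

Lemma ccvg_cst a : ccvg (fun=> a) a.
Proof. by split; apply: cvg_cst. Qed.

Lemma ccvg_unique z a b : ccvg z a -> ccvg z b -> a = b.
Proof.
move=> [h1 h2] [h3 h4]; apply/eqP; rewrite eq_complex.
by rewrite (cvg_unique _ h1 h3) ?(cvg_unique _ h2 h4) ?eqxx//; apply: Rhausdorff.
Qed.

Lemma ccvgD z z' a b : ccvg z a -> ccvg z' b -> ccvg (fun t => z t + z' t) (a + b).
Proof.
move=> [h1 h2] [h3 h4]; split; rewrite raddfD /=.
  by under eq_fun do rewrite raddfD /=; apply: cvgD.
by under eq_fun do rewrite raddfD /=; apply: cvgD.
Qed.

Lemma ccvgM z z' a b : ccvg z a -> ccvg z' b -> ccvg (fun t => z t * z' t) (a * b).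
Proof.
move=> [h1 h2] [h3 h4]; have reM (x y : R[i]) :
    complex.Re (x * y) = complex.Re x * complex.Re y - complex.Im x * complex.Im y.
  by case: x y => [? ?] [? ?].
have imM (x y : R[i]) :
    complex.Im (x * y) = complex.Re x * complex.Im y + complex.Im x * complex.Re y.
  by case: x y => [? ?] [? ?].
split; rewrite (reM, imM).
  by under eq_fun do rewrite reM; apply: cvgB; apply: cvgM.
by under eq_fun do rewrite imM; apply: cvgD; apply: cvgM.
Qed.

Lemma ccvg_conj z a : ccvg z a -> ccvg (fun t => Num.conj (z t)) (Num.conj a).
Proof.
move=> [h1 h2]; split.
  by case: a h1 {h2} => a b /=; apply: cvg_trans;
     apply: near_eq_cvg; apply: nearW => t; case: (z t).
have -> : complex.Im (Num.conj a) = - complex.Im a by case: a {h1 h2}.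
have -> : (fun t => complex.Im (Num.conj (z t))) = (fun t => - complex.Im (z t)).
  by apply/funext => t; case: (z t).
exact: cvgN.
Qed.

Lemma ccvg_real (f : nat -> R) (l : R) :
  f t @[t --> F] --> l -> ccvg (fun t => (f t)%:C) l%:C.
Proof. by move=> h; split => //; apply: cvg_cst. Qed.

Lemma ccvg_sum (I : Type) (r : seq I) (z : I -> nat -> R[i]) (a : I -> R[i]) :
  (forall i, ccvg (z i) (a i)) ->
  ccvg (fun t => \sum_(i <- r) z i t) (\sum_(i <- r) a i).
Proof.
move=> h; elim: r => [|i r ih].
  by rewrite big_nil; under eq_fun do rewrite big_nil; exact: ccvg_cst.
by rewrite big_cons; under eq_fun do rewrite big_cons; exact: ccvgD.
Qed.

Lemma mxcvg_cst m n (A : 'M[R[i]]_(m, n)) : mxcvg (fun=> A) A.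
Proof. by move=> i j; apply: ccvg_cst. Qed.

Lemma mxcvg_unique m n M (A B : 'M[R[i]]_(m, n)) : mxcvg M A -> mxcvg M B -> A = B.
Proof. by move=> h h'; apply/matrixP => i j; apply: ccvg_unique (h i j) (h' i j). Qed.

Lemma mxcvgD m n M M' (A B : 'M[R[i]]_(m, n)) :
  mxcvg M A -> mxcvg M' B -> mxcvg (fun t => M t + M' t) (A + B).
Proof.
by move=> h h' i j; rewrite mxE; under eq_fun do rewrite mxE; exact: ccvgD.
Qed.

Lemma mxcvgZ m n z M a (A : 'M[R[i]]_(m, n)) :
  ccvg z a -> mxcvg M A -> mxcvg (fun t => z t *: M t) (a *: A).
Proof.
by move=> h h' i j; rewrite mxE; under eq_fun do rewrite mxE; exact: ccvgM.
Qed.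

Lemma mxcvgM m n p M M' (A : 'M[R[i]]_(m, n)) (B : 'M_(n, p)) :
  mxcvg M A -> mxcvg M' B -> mxcvg (fun t => M t *m M' t) (A *m B).
Proof.
move=> h h' i j; rewrite mxE; under eq_fun do rewrite mxE.
by apply: ccvg_sum => l; exact: ccvgM.
Qed.

Lemma mxcvg_adj m n M (A : 'M[R[i]]_(m, n)) :
  mxcvg M A -> mxcvg (fun t => M t ^t*) (A ^t*).
Proof.
by move=> h i j; rewrite !mxE; under eq_fun do rewrite !mxE; exact: ccvg_conj.
Qed.

End Limits.

(** Replaces the extraction of subsequences: all bounded sequences converge along one and the same
    filter. A compact segment supplies a cluster point, and a cluster point of an ultrafilter is a
    limit. *)
Lemma ultra_real (R : realType) (F : set_system nat) (f : nat -> R) (b : R) :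
  UltraFilter F -> (forall t, `|f t| <= b) ->
  exists l : R, (f t @[t --> F] --> l)%classic.
Proof.
move=> UF fb; have PF : ProperFilter (f t @[t --> F])%classic.
  by apply: fmap_proper_filter; exact: (@ultra_proper _ _ UF).
have [|l [_ fl]] := @segment_compact R (- b) b _ PF.
  suff : F (f @^-1` `[- b, b])%classic by [].
  by have PF0 := @ultra_proper _ _ UF; apply: filterE => t; rewrite /= in_itv /= -ler_norml.
exists l => V Vl; have [//|nV] := in_ultra_setVsetC (f @^-1` V)%classic UF.
by have [x [nVx Vx]] := fl (~` V)%classic V nV Vl.
Qed.

Lemma ultra_mx (R : realType) (F : set_system nat) m n (M : nat -> 'M[R[i]]_(m, n)) :
  UltraFilter F -> (forall t i j, `|M t i j| <= 1) ->
  exists L, mxcvg F M L.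
Proof.
move=> UF Mb.
have hRe i j : exists l : R, (complex.Re (M t i j) @[t --> F] --> l)%classic.
  apply: (@ultra_real _ _ _ 1) => // t; have := Mb t i j.
  by rewrite -lecR; apply: le_trans; apply: normc_ge_Re.
have hIm i j : exists l : R, (complex.Im (M t i j) @[t --> F] --> l)%classic.
  apply: (@ultra_real _ _ _ 1) => // t; have := Mb t i j.
  rewrite -lecR; apply: le_trans; rewrite -normrN -ReiNIm.
  by apply: le_trans (normc_ge_Re _) _; rewrite normrM complexiE normCi mulr1.
pose re i j := projT1 (cid (hRe i j)); pose im i j := projT1 (cid (hIm i j)).
exists (\matrix_(i, j) (re i j +i* im i j)) => i j; rewrite mxE /ccvg /=.
by split; rewrite /re /im; case: cid.
Qed.

(** * Singular values and Ky Fan's inequality *)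

Section Adjoint.
Variable R : realType.
Local Notation C := R[i].

Lemma adjmxM m n p (A : 'M[C]_(m, n)) (B : 'M_(n, p)) :
  (A *m B) ^t* = B ^t* *m A ^t*.
Proof. by rewrite trmx_mul map_mxM. Qed.

Lemma adjmxD m n (A B : 'M[C]_(m, n)) : (A + B) ^t* = A ^t* + B ^t*.
Proof. by apply/matrixP => i j; rewrite !mxE rmorphD. Qed.

Lemma adjmxZ m n a (A : 'M[C]_(m, n)) : (a *: A) ^t* = Num.conj a *: A ^t*.
Proof. by apply/matrixP => i j; rewrite !mxE rmorphM. Qed.

Lemma adj_diag_real k (f : 'I_k -> R) :
  (diag_mx (\row_j (f j)%:C)) ^t* = diag_mx (\row_j (f j)%:C) :> 'M[C]_k.
Proof.
rewrite tr_diag_mx map_diag_mx; congr diag_mx; apply/rowP => j.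
by rewrite !mxE; exact: conjc_real.
Qed.

(** Squared modulus with values in [R], where real powers and ordered-field reasoning apply; [nsq]
    is its analogue for vectors. *)
Definition sqn (z : C) : R := complex.Re z ^+ 2 + complex.Im z ^+ 2.

Lemma sqn_ge0 z : 0 <= sqn z.
Proof. by rewrite addr_ge0 ?sqr_ge0. Qed.

Lemma conjM_sqn z : Num.conj z * z = (sqn z)%:C.
Proof. by rewrite add_Re2_Im2 normCK mulrC. Qed.

Lemma sqn_eq0 z : sqn z = 0 -> z = 0.
Proof.
rewrite /sqn => h; have := add_Re2_Im2 z; rewrite h => /esym/eqP.
by rewrite expf_eq0 /= normr_eq0 => /eqP.
Qed.

Definition nsq n (x : 'cV[C]_n) : R := complex.Re (inner x x).

Lemma inner_sum n (x y : 'cV[C]_n) : inner x y = \sum_i Num.conj (y i 0) * x i 0.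
Proof. by rewrite /inner mxE; apply: eq_bigr => i _; rewrite !mxE. Qed.

Lemma nsq_sum n (x : 'cV[C]_n) : nsq x = \sum_i sqn (x i 0).
Proof.
rewrite /nsq inner_sum; transitivity (complex.Re (\sum_i (sqn (x i 0)))%:C) => //.
by rewrite rmorph_sum; congr complex.Re; apply: eq_bigr => i _; rewrite conjM_sqn.
Qed.

Lemma inner_nsq n (x : 'cV[C]_n) : inner x x = (nsq x)%:C.
Proof.
rewrite nsq_sum inner_sum rmorph_sum.
by apply: eq_bigr => i _; rewrite conjM_sqn.
Qed.

Lemma nsq_ge0 n (x : 'cV[C]_n) : 0 <= nsq x.
Proof. by rewrite nsq_sum sumr_ge0// => i _; apply: sqn_ge0. Qed.

Lemma nsq_eq0 n (x : 'cV[C]_n) : nsq x = 0 -> x = 0.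
Proof.
rewrite nsq_sum => /psumr_eq0P h; apply/colP => i; rewrite mxE.
by apply/sqn_eq0/h => // j _; apply: sqn_ge0.
Qed.

Lemma inner_mulmxl m n (A : 'M[C]_(m, n)) x y : inner (A *m x) y = inner x (A ^t* *m y).
Proof. by rewrite /inner adjmxM trmxCK mulmxA. Qed.

Lemma inner_conj n (x y : 'cV[C]_n) : Num.conj (inner x y) = inner y x.
Proof.
rewrite !inner_sum rmorph_sum; apply: eq_bigr => i _.
by rewrite rmorphM /= conjCK mulrC.
Qed.

Lemma innerDl n (x y z : 'cV[C]_n) : inner (x + y) z = inner x z + inner y z.
Proof. by rewrite /inner mulmxDr mxE. Qed.

Lemma innerDr n (x y z : 'cV[C]_n) : inner z (x + y) = inner z x + inner z y.
Proof. by rewrite /inner adjmxD mulmxDl mxE. Qed.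

Lemma innerZl n a (x z : 'cV[C]_n) : inner (a *: x) z = a * inner x z.
Proof. by rewrite /inner -scalemxAr mxE. Qed.

Lemma innerZr n a (x z : 'cV[C]_n) : inner z (a *: x) = Num.conj a * inner z x.
Proof. by rewrite /inner adjmxZ -scalemxAl mxE. Qed.

Lemma adjmx_mulE n k l (V : 'M[C]_(n, k)) (W : 'M_(n, l)) i j :
  (W ^t* *m V) i j = inner (col j V) (col i W).
Proof. by rewrite inner_sum mxE; apply: eq_bigr => r _; rewrite !mxE. Qed.

Lemma quadmxE n k (M : 'M[C]_n) (V : 'M_(n, k)) i j :
  (V ^t* *m M *m V) i j = inner (M *m col j V) (col i V).
Proof. by rewrite -mulmxA adjmx_mulE !colE mulmxA. Qed.

Lemma gram_herm m n (X : 'M[C]_(m, n)) : (gram X) ^t* = gram X.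
Proof. by rewrite /gram adjmxM trmxCK. Qed.

Lemma gramE m n (X : 'M[C]_(m, n)) x y : inner (gram X *m x) y = inner (X *m x) (X *m y).
Proof. by rewrite /gram -mulmxA inner_mulmxl trmxCK. Qed.

End Adjoint.

Section SingularValues.
Variable R : realType.
Local Notation C := R[i].

(** Indexing [s] by [nat] lets one sequence of singular values serve for every size k. *)
Definition sqdiag (s : nat -> R) k : 'M[C]_k :=
  diag_mx (\row_(j < k) (s j ^+ 2)%:C).

Lemma sigma_ge0 m n (X : 'M[C]_(m, n)) i : 0 <= sigma X i.
Proof.
rewrite /sigma; have [h|h] := ltnP i (size (singular_values X)); last by rewrite nth_default.
have := mem_nth 0 h; rewrite /singular_values mem_sort => /mapP[j _ ->].
exact: sqrtr_ge0.
Qed.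

Lemma size_singular_values m n (X : 'M[C]_(m, n)) : size (singular_values X) = n.
Proof. by rewrite size_sort size_map size_enum_ord. Qed.

Lemma sigma_nonincr m n (X : 'M[C]_(m, n)) i j : (i <= j < n)%N -> sigma X j <= sigma X i.
Proof.
move=> /andP[ij jn]; have sor : sorted (fun x y : R => y <= x) (singular_values X).
  by apply: sort_sorted => x y; apply: le_total.
apply: (sorted_leq_nth _ _ 0 sor) => //; last 2 first.
- by rewrite inE size_singular_values (leq_ltn_trans ij).
- by rewrite inE size_singular_values.
- by move=> x y z h1 h2; apply: le_trans h2 h1.
Qed.

(** The spectral theorem lists the eigenvalues in an arbitrary order, whereas [sigma] is sorted; the
    sorting permutation [pi] is applied to the columns of the unitary eigenbasis. *)
Lemma sigma_eigenbasis m n (X : 'M[C]_(m, n)) : exists E : 'M[C]_n,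
  E ^t* *m E = 1%:M /\ gram X *m E = E *m sqdiag (sigma X) n.
Proof.
pose H := gram X; pose P := spectralmx H; pose D := spectral_diag H.
have Pu : P \is unitarymx by apply: spectral_unitarymx.
have PP : P *m P ^t* = 1%:M by apply/unitarymxP.
have HP : H *m P ^t* = P ^t* *m diag_mx D.
  have /orthomx_spectralP : H \is normalmx by apply/normalmxP; rewrite gram_herm.
  rewrite -/P -/D invmx_unitary// => ->; rewrite -!mulmxA PP mulmx1 //.
pose s j := Num.sqrt (complex.Re (D 0 j)).
have Ds j : D 0 j = (s j ^+ 2)%:C.
  (* An eigenvalue is the squared length of the image under X of a unit eigenvector, hence real and
     nonnegative: neither Re nor the square root loses anything. *)
  have : D 0 j = (nsq (X *m col j (P ^t*)))%:C.
    rewrite -inner_nsq -gramE -quadmxE -mulmxA HP mulmxA trmxCK PP mul1mx.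
    by rewrite mxE eqxx mulr1n.
  by move=> h; rewrite /s sqr_sqrtr h //= nsq_ge0.
have : perm_eq (singular_values X) [tuple s j | j < n].
  by rewrite /singular_values perm_sort.
move=> /tuple_permP[pi /(congr1 (nth 0)) hpi].
have sig j : sigma X (nat_of_ord j) = s (pi j).
  rewrite /sigma hpi -tnth_nth tnth_mktuple tnth_mktuple //.
exists (\matrix_(i, j) P ^t* i (pi j)); split.
  apply/matrixP => i j; have /matrixP/(_ (pi i) (pi j)) := PP.
  rewrite !mxE (inj_eq perm_inj) => <-; apply: eq_bigr => l _.
  by rewrite !mxE conjCK.
apply/matrixP => i j; rewrite /sqdiag mul_mx_diag [RHS]mxE.
have /matrixP/(_ i (pi j)) := HP.
rewrite mul_mx_diag [X in _ = X]mxE Ds !mxE sig => <-.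
by apply: eq_bigr => l _; rewrite !mxE.
Qed.

End SingularValues.

Lemma weighted_sum_le (R : realType) n k (d : 'I_n -> R) (g : nat -> R) :
  (0 < k <= n)%N -> (forall j, 0 <= d j <= 1) -> \sum_j d j = k%:R ->
  (forall i j, (i <= j < n)%N -> g j <= g i) ->
  \sum_j d j * g j <= \sum_(i < k) g i.
Proof.
move=> /andP[k0 kn] d01 dk gmon.
have E (f : nat -> R) : \sum_(i < k) f i = \sum_(j < n) (j < k)%:R * f j.
  rewrite (big_ord_widen _ f kn) big_mkcond /=; apply: eq_bigr => j _.
  by case: ifP; rewrite (mul1r, mul0r).
rewrite E -subr_ge0 -sumrB.
(* Both families of weights have total k, so the k-th value [g k.-1] can be subtracted from every
   [g j]. Then the two factors of each term have the same sign. *)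
have -> : \sum_(j < n) ((j < k)%:R * g j - d j * g j) =
   \sum_(j < n) ((j < k)%:R - d j) * (g j - g k.-1).
  apply/eqP; rewrite -subr_eq0 -sumrB; apply/eqP.
  transitivity (\sum_(j < n) ((j < k)%:R * 1 - d j) * g k.-1).
    by apply: eq_bigr => j _; ring.
  rewrite -mulr_suml sumrB dk -(E (fun=> 1)) sumr_const card_ord.
  by rewrite subrr mul0r.
apply: sumr_ge0 => j _; have /andP[d0 d1] := d01 j.
have [jk|kj] := ltnP j k.
  rewrite mulr_ge0 ?subr_ge0//; apply: gmon.
  by apply/andP; split; [rewrite -ltnS prednK | rewrite prednK].
rewrite /= sub0r mulNr -mulrN opprB mulr_ge0 ?subr_ge0//; apply: gmon.
by rewrite ltn_ord andbT (leq_trans _ kj)// leq_pred.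
Qed.

(** Take the tangent at the mean [a]; averaged with the weights c, its linear term vanishes. *)
Lemma jensen_powR (R : realType) n (c x : 'I_n -> R) (q : R) : 1 <= q ->
  (forall j, 0 <= c j) -> (forall j, 0 <= x j) -> \sum_j c j = 1 ->
  (\sum_j c j * x j) `^ q <= \sum_j c j * x j `^ q.
Proof.
move=> q1 c0 x0 c1; set a := \sum_j _; have a0 : 0 <= a.
  by apply: sumr_ge0 => j _; apply: mulr_ge0.
apply: (@le_trans _ _ (\sum_j c j * (a `^ q + q * a `^ (q - 1) * (x j - a)))); last first.
  by apply: ler_sum => j _; apply: ler_wpM2l => //; apply: powR_tangent.
have -> : \sum_j c j * (a `^ q + q * a `^ (q - 1) * (x j - a)) =
   \sum_j (c j * a `^ q + (c j * x j) * (q * a `^ (q - 1)) - c j * (a * (q * a `^ (q - 1)))).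
  by apply: eq_bigr => j _; ring.
rewrite sumrB big_split /= -!mulr_suml c1 -/a.
by lra.
Qed.

Section KyFan.
Variable R : realType.
Local Notation C := R[i].

(** The diagonal entry d of the projection Q = W W^* is also the squared length of the j-th column
    of Q, whence d^2 <= d. *)
Lemma isometry_row_le1 n k (W : 'M[C]_(n, k)) j :
  W ^t* *m W = 1%:M -> \sum_i sqn (W j i) <= 1.
Proof.
move=> WW; pose Q := W *m W ^t*.
have QQ : Q *m Q = Q by rewrite /Q mulmxA -(mulmxA W) WW mulmx1.
have Qh : Q ^t* = Q by rewrite /Q adjmxM trmxCK.
have Qjj : Q j j = (\sum_i sqn (W j i))%:C.
  rewrite mxE rmorph_sum; apply: eq_bigr => i _.
  by rewrite !mxE mulrC conjM_sqn.
set d := \sum_i _; have : d ^+ 2 <= d.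
  have : (d%:C = (\sum_l sqn (Q l j))%:C).
    rewrite -Qjj -{1}QQ -{1}Qh mxE rmorph_sum; apply: eq_bigr => l _.
    by rewrite !mxE conjM_sqn.
  move=> /complexI {2}->; rewrite (bigD1 j)//= Qjj /sqn /= -/d expr0n addr0 lerDl.
  by apply: sumr_ge0 => l _; apply: sqn_ge0.
nra.
Qed.

(** In the singular basis E, the squared moduli of the coordinates of V have column sums 1 and row
    sums at most 1. The columns allow Jensen's inequality; the rows, with total k, allow
    [weighted_sum_le]. *)
Lemma kyfan_le m n k (X : 'M[C]_(m, n)) (V : 'M_(n, k)) (q : R) :
  (0 < k <= n)%N -> 1 <= q -> V ^t* *m V = 1%:M ->
  \sum_i nsq (X *m col i V) `^ q <= \sum_(i < k) (sigma X i ^+ 2) `^ q.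
Proof.
move=> kn q1 VV; have [E [EE HE]] := sigma_eigenbasis X.
have EE' := mulmx1C EE.
have [W VE WW] : exists2 W, V = E *m W & W ^t* *m W = 1%:M.
  exists (E ^t* *m V); first by rewrite mulmxA EE' mul1mx.
  by rewrite adjmxM trmxCK mulmxA -(mulmxA (V ^t*)) EE' mulmx1.
have nE i : nsq (X *m col i V) = \sum_j sqn (W j i) * sigma X j ^+ 2.
  apply: complexI; rewrite -inner_nsq -gramE -quadmxE VE -mulmxA (mulmxA (gram X)) HE.
  rewrite adjmxM !mulmxA -(mulmxA (W ^t*)) EE mulmx1 mul_mx_diag mxE.
  rewrite rmorph_sum; apply: eq_bigr => j _.
  by rewrite !mxE [in RHS]rmorphM /= -conjM_sqn mulrAC.
have sumW i : \sum_j sqn (W j i) = 1.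
  have /matrixP/(_ i i) := WW; rewrite mxE [in RHS]mxE eqxx => h.
  apply: complexI; rewrite -[RHS]h rmorph_sum; apply: eq_bigr => l _.
  by rewrite !mxE conjM_sqn.
pose g j := (sigma X j ^+ 2) `^ q.
apply: (@le_trans _ _ (\sum_(i < k) \sum_j sqn (W j i) * g j)).
  apply: ler_sum => i _; rewrite nE; apply: jensen_powR => [//|j|j|].
  - exact: sqn_ge0.
  - exact: sqr_ge0.
  - exact: sumW.
rewrite exchange_big /=.
under eq_bigr do rewrite -mulr_suml.
apply: weighted_sum_le => //.
- move=> j; rewrite isometry_row_le1// andbT.
  by apply: sumr_ge0 => i _; apply: sqn_ge0.
- rewrite exchange_big /=; transitivity (\sum_(i < k) (1 : R)).
    by apply: eq_bigr => i _; apply: sumW.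
  by rewrite sumr_const card_ord.
- move=> i j ij; apply: ge0_ler_powR; rewrite ?nnegrE ?sqr_ge0//; first lra.
  by rewrite ler_sqr ?nnegrE ?sigma_ge0// sigma_nonincr.
Qed.

End KyFan.

(** * The norm and its homogeneity *)

Lemma powR_ler_inv (R : realType) (p x y : R) : 0 < p -> 0 <= x -> 0 <= y ->
  x `^ p <= y `^ p -> x <= y.
Proof.
move=> p0 x0 y0; apply: contraTT; rewrite -!ltNge => yx.
by apply: gt0_ltr_powR.
Qed.

Lemma sqr_powR_half (R : realType) (x p : R) : 0 <= x -> (x ^+ 2) `^ (p / 2) = x `^ p.
Proof. by move=> x0; rewrite -powR_mulrn// -powRrM mulrC divfK ?pnatr_eq0. Qed.

Lemma powR_pred (R : realType) (x p : R) : 0 <= x -> p != 0 ->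
  x `^ (p - 1) * x = x `^ p.
Proof.
move=> x0 p0; rewrite -{2}(powRr1 x0) -powRD subrK//.
by rewrite (negPf p0).
Qed.

Lemma holder_sum (R : realType) k (s y : 'I_k -> R) (p N M : R) : 1 < p ->
  (forall i, 0 <= s i) -> (forall i, 0 <= y i) -> 0 < N -> 0 <= M ->
  \sum_i s i `^ p = N `^ p -> \sum_i y i `^ p <= M `^ p ->
  \sum_i s i `^ (p - 1) * y i <= N `^ (p - 1) * M.
Proof.
move=> p1 s0 y0 N0; have p0 : 0 < p by lra.
rewrite le_eqVlt => /predU1P[<- _|M0 sN yM].
  rewrite powR0 ?gt_eqF// => h; rewrite mulr0 big1// => i _.
  have : y i `^ p <= 0.
    apply: le_trans h; rewrite (bigD1 i)//= lerDl.
    by apply: sumr_ge0 => j _; apply: powR_ge0.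
  rewrite -[leRHS](powR0 (lt0r_neq0 p0)) => /(powR_ler_inv p0 (y0 i) (lexx 0)) yi0.
  have /eqP-> : y i == 0 by rewrite eq_le y0 yi0.
  by rewrite mulr0.
have Np : 0 < N `^ p by apply: powR_gt0.
have Mp : 0 < M `^ p by apply: powR_gt0.
have Np1 : 0 < N `^ (p - 1) by apply: powR_gt0.
have divpow (x z r : R) : 0 <= x -> 0 < z -> (x / z) `^ r = x `^ r / z `^ r.
  move=> x0 /ltW z0; rewrite powRM ?invr_ge0// -[z^-1]powR_inv1//.
  by rewrite -powRrM mulN1r powRN.
have sum1 : \sum_i (s i / N) `^ p = 1.
  under eq_bigr do rewrite divpow//.
  by rewrite -mulr_suml sN divff// gt_eqF.
have sum2 : \sum_i (y i / M) `^ p <= 1.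
  under eq_bigr do rewrite divpow//.
  by rewrite -mulr_suml ler_pdivrMr// mul1r.
have sum3 : \sum_i (s i / N) `^ (p - 1) * (s i / N) = 1.
  rewrite -[RHS]sum1; apply: eq_bigr => i _.
  by rewrite powR_pred// ?gt_eqF// divr_ge0// ltW.
(* Sum the tangent inequalities at s_i/N towards y_i/M: the p-th powers total 1 on the left and at
   most 1 on the right, so the linear terms total at most 0. *)
have key : \sum_i (s i / N) `^ (p - 1) * (y i / M) <= 1.
  have : \sum_i ((s i / N) `^ p + p * (s i / N) `^ (p - 1) * (y i / M - s i / N))
      <= \sum_i (y i / M) `^ p.
    apply: ler_sum => i _; apply: powR_tangent; rewrite ?divr_ge0 ?(ltW N0) ?(ltW M0)//.
    exact: ltW.
  rewrite big_split /= sum1.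
  have -> : \sum_i p * (s i / N) `^ (p - 1) * (y i / M - s i / N) =
      p * (\sum_i (s i / N) `^ (p - 1) * (y i / M) - 1).
    rewrite -[X in p * (_ - X)]sum3 -sumrB mulr_sumr; apply: eq_bigr => i _; ring.
  move=> /le_trans/(_ sum2); rewrite gerDl pmulr_rle0// subr_le0 //.
have -> : \sum_i s i `^ (p - 1) * y i =
    N `^ (p - 1) * M * \sum_i (s i / N) `^ (p - 1) * (y i / M).
  rewrite mulr_sumr; apply: eq_bigr => i _; rewrite divpow//.
  by field; rewrite !gt_eqF.
by rewrite -[leRHS]mulr1 ler_pM2l// mulr_gt0.
Qed.

Section KyFanNorm.
Variable R : realType.
Local Notation C := R[i].

Lemma normC_Re (z : C) : (complex.Re `|z|)%:C = `|z|.
Proof. by rewrite RRe_real// normr_real. Qed.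

Lemma conjC_real (x : R) : Num.conj x%:C = x%:C :> C.
Proof. exact: conjc_real. Qed.

Lemma cauchy_schwarz n (x y : 'cV[C]_n) : sqn (inner x y) <= nsq x * nsq y.
Proof.
have [y0|yn0] := eqVneq (nsq y) 0.
  have -> : inner x y = 0.
    rewrite (nsq_eq0 y0) inner_sum big1// => i _.
    by rewrite mxE rmorph0 mul0r.
  by rewrite /sqn /= expr0n addr0 mulr_ge0 ?nsq_ge0.
have ny : 0 < nsq y by rewrite lt_neqAle nsq_ge0 andbT eq_sym.
(* This vector is [nsq y] times the component of x orthogonal to y. *)
have : nsq ((nsq y)%:C *: x + (- inner x y) *: y) =
    nsq y * (nsq x * nsq y - sqn (inner x y)).
  apply: complexI; rewrite -[LHS]inner_nsq innerDl !innerDr !innerZl !innerZr.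
  rewrite -(inner_conj x y) !inner_nsq rmorphN /= conjC_real.
  rewrite !(rmorphM, rmorphB) /= -conjM_sqn; ring.
by move=> h; have := nsq_ge0 ((nsq y)%:C *: x + (- inner x y) *: y);
  rewrite h pmulr_rge0// subr_ge0.
Qed.

Lemma cauchy_schwarz_sqrt n (x y : 'cV[C]_n) :
  `|inner x y| <= (Num.sqrt (nsq x) * Num.sqrt (nsq y))%:C.
Proof.
by rewrite normc_def lecR -sqrtrM ?nsq_ge0// ler_wsqrtr// cauchy_schwarz.
Qed.

Lemma kyfan_ge0 m n p k (X : 'M[C]_(m, n)) : 0 <= kyfan p k X.
Proof. exact: powR_ge0. Qed.

Lemma kyfan_powR m n p k (X : 'M[C]_(m, n)) : 0 < p ->
  kyfan p k X `^ p = \sum_(i < k) sigma X i `^ p.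
Proof.
move=> p0; rewrite /kyfan -powRrM mulVf ?gt_eqF// powRr1//.
by apply: sumr_ge0 => i _; apply: powR_ge0.
Qed.

Lemma kyfan_sum_le m n p k (X : 'M[C]_(m, n)) (V : 'M_(n, k)) :
  (0 < k <= n)%N -> 2 <= p -> V ^t* *m V = 1%:M ->
  \sum_i nsq (X *m col i V) `^ (p / 2) <= kyfan p k X `^ p.
Proof.
move=> kn p2 VV; rewrite kyfan_powR; last lra.
rewrite -(eq_bigr _ (fun i _ => sqr_powR_half p (sigma_ge0 X (nat_of_ord i)))).
by apply: kyfan_le => //; lra.
Qed.

(** The columns are the vectors v_i of the theorem. In matrix form the conditions pass directly to
    entrywise limits and to products with unitary matrices. *)
Definition right_singular m n k (A : 'M[C]_(m, n)) (V : 'M[C]_(n, k)) : Prop :=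
  V ^t* *m V = 1%:M /\ gram A *m V = V *m sqdiag (sigma A) k.

Definition first_cols n l k (kl : (k <= l)%N) (E : 'M[C]_(n, l)) : 'M[C]_(n, k) :=
  colsub (widen_ord kl) E.

Lemma right_singular_first_cols m n l k (kl : (k <= l)%N) (X : 'M[C]_(m, n))
    (E : 'M[C]_(n, l)) : right_singular X E -> right_singular X (first_cols kl E).
Proof.
move=> [EE HE]; split; apply/matrixP => i j.
  have /matrixP/(_ (widen_ord kl i) (widen_ord kl j)) := EE.
  rewrite !mxE -val_eqE /= => <-; apply: eq_bigr => r _.
  by rewrite !mxE.
have /matrixP/(_ i (widen_ord kl j)) := HE; rewrite !mul_mx_diag.
rewrite [X in _ = X]mxE [X in _ -> _ = X]mxE !mxE /= => <-.
by apply: eq_bigr => r _; rewrite !mxE.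
Qed.

Lemma right_singular_exists m n k (A : 'M[C]_(m, n)) : (k <= n)%N ->
  exists V : 'M_(n, k), right_singular A V.
Proof.
move=> kn; have [E HE] := sigma_eigenbasis A.
by exists (first_cols kn E); apply: right_singular_first_cols.
Qed.

Lemma right_singular_nsq m n k (A : 'M[C]_(m, n)) (V : 'M_(n, k)) i :
  right_singular A V -> nsq (A *m col i V) = sigma A i ^+ 2.
Proof.
move=> [VV HV]; apply: complexI; rewrite -inner_nsq -gramE -quadmxE -mulmxA HV.
by rewrite mulmxA VV mul1mx !mxE eqxx mulr1n.
Qed.

Lemma nsqZ n a (x : 'cV[C]_n) : nsq (a *: x) = sqn a * nsq x.
Proof.
apply: complexI; rewrite -inner_nsq innerZl innerZr mulrA rmorphM /=.
by rewrite [a * _]mulrC conjM_sqn inner_nsq.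
Qed.

Lemma sqn_Re_norm (a : C) : complex.Re `|a| ^+ 2 = sqn a.
Proof. by apply: complexI; rewrite rmorphXn /= normC_Re -conjM_sqn normCKC. Qed.

(** Ky Fan's inequality for a X, tested on right singular vectors of X, avoids computing the
    singular values of a X. The reverse inequality follows by scaling back with the inverse of a. *)
Lemma kyfanZ_ge m n p k a (X : 'M[C]_(m, n)) : (0 < k <= n)%N -> 2 <= p ->
  complex.Re `|a| * kyfan p k X <= kyfan p k (a *: X).
Proof.
move=> kn p2; have p0 : 0 < p by lra.
have a0 : 0 <= complex.Re `|a| by rewrite -ler0c normC_Re.
have [|V HV] := @right_singular_exists _ _ k X; first by case/andP: kn.
apply: (powR_ler_inv p0); rewrite ?mulr_ge0 ?kyfan_ge0//.
apply: le_trans (kyfan_sum_le _ kn p2 HV.1).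
rewrite powRM ?kyfan_ge0// kyfan_powR// mulr_sumr.
apply: ler_sum => i _; rewrite -scalemxAl nsqZ right_singular_nsq// powRM ?sqn_ge0 ?sqr_ge0//.
by rewrite -sqn_Re_norm !sqr_powR_half ?sigma_ge0.
Qed.

Lemma kyfanZ m n p k a (X : 'M[C]_(m, n)) : (0 < k <= n)%N -> 2 <= p ->
  kyfan p k (a *: X) = complex.Re `|a| * kyfan p k X.
Proof.
move=> kn p2; apply/eqP; rewrite eq_le kyfanZ_ge// andbT.
have [->|an0] := eqVneq a 0.
  rewrite normr0 mul0r scale0r.
  (* Since 2 * 0 = 0, the norm of the zero matrix is at least twice itself, hence is 0. *)
  have := kyfanZ_ge (2 : R)%:C (0 : 'M[C]_(m, n)) kn p2.
  by rewrite scaler0 ger0_norm ?ler0c//=; lra.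
have := kyfanZ_ge a^-1 (a *: X) kn p2.
rewrite scalerA mulVf// scale1r normfV.
have an : 0 < complex.Re `|a| by rewrite -ltcR normC_Re normr_gt0.
have -> : complex.Re `|a|^-1 = (complex.Re `|a|)^-1.
  by rewrite -{1}normC_Re -fmorphV.
by rewrite ler_pdivrMl.
Qed.

Lemma kyfan_gt0 m n p k (A : 'M[C]_(m, n)) : (0 < k <= n)%N -> A != 0 -> 0 < kyfan p k A.
Proof.
move=> /andP[k0 kn] A0; apply: powR_gt0.
have n0 : (0 < n)%N by apply: leq_trans kn.
suff s0 : 0 < sigma A 0.
  rewrite (bigD1 (Ordinal k0))//= ltr_pwDl ?powR_gt0//.
  by apply: sumr_ge0 => i _; apply: powR_ge0.
rewrite lt_neqAle sigma_ge0 andbT; apply: contra_neq A0 => /esym s0.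
have sj j : (j < n)%N -> sigma A j = 0.
  move=> jn; apply/eqP; rewrite eq_le sigma_ge0 andbT -s0.
  by apply: sigma_nonincr; rewrite jn.
have [E [EE HE]] := sigma_eigenbasis A.
have G0 : gram A = 0.
  rewrite -(mulmx1 (gram A)) -(mulmx1C EE) mulmxA HE.
  have -> : sqdiag (sigma A) n = 0.
    apply/matrixP => i j; rewrite !mxE sj ?ltn_ord//.
    by rewrite expr0n /= mul0rn.
  by rewrite mulmx0 mul0mx.
apply/matrixP => i j; rewrite [RHS]mxE.
have : nsq (A *m col j 1%:M) = 0.
  by apply: complexI; rewrite -inner_nsq -gramE G0 mul0mx /inner mulmx0 mxE.
by move=> /nsq_eq0/colP/(_ i); rewrite !colE mul1mx -colE !mxE.
Qed.

(** The power is defined by one chosen eigenbasis, but v may be any eigenvector. In that basis each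
    coordinate of v vanishes or belongs to the eigenvalue s^2, so the power still acts on v as a
    scalar. *)
Lemma psd_pow_gram m n (A : 'M[C]_(m, n)) (s r : R) (v : 'cV[C]_n) :
  gram A *m v = (s ^+ 2)%:C *: v ->
  psd_pow (gram A) r *m v = ((s ^+ 2) `^ r)%:C *: v.
Proof.
set H := gram A; have Pu : spectralmx H \is unitarymx by apply: spectral_unitarymx.
have /orthomx_spectralP : H \is normalmx by apply/normalmxP; rewrite gram_herm.
rewrite /psd_pow; set P := spectralmx H; set D := spectral_diag H => HE.
have Pi : P \in unitmx by apply: unitarymx_unit.
rewrite HE => h; have {h}Dv : diag_mx D *m (P *m v) = (s ^+ 2)%:C *: (P *m v).
  have := congr1 (mulmx P) h; rewrite !mulmxA mulmxV// mul1mx => ->.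
  by rewrite -scalemxAr.
rewrite -!mulmxA; set w := P *m v in Dv *.
have -> : v = invmx P *m w by rewrite mulKmx.
rewrite scalemxAr; congr (_ *m _); apply/colP => i.
have /colP/(_ i) := Dv; rewrite !mul_diag_mx !mxE => /eqP.
rewrite -subr_eq0 -mulrBl mulf_eq0 subr_eq0 => /orP[/eqP->//|/eqP->].
by rewrite !mulr0.
Qed.

Lemma psd_pow_herm m n (A : 'M[C]_(m, n)) (r : R) :
  (psd_pow (gram A) r) ^t* = psd_pow (gram A) r.
Proof.
rewrite /psd_pow invmx_unitary ?spectral_unitarymx//.
rewrite !adjmxM trmxCK mulmxA; congr (_ *m _ *m _).
rewrite tr_diag_mx map_diag_mx; congr diag_mx; apply/rowP => j.
by rewrite !mxE; exact: conjC_real.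
Qed.

End KyFanNorm.

(** * The dual functional *)

Section DualFunctional.
Variables (R : realType) (m n k : nat) (A : 'M[R[i]]_(m, n)) (p : R).
Hypotheses (kn : (0 < k <= n)%N) (p2 : 2 <= p).
Local Notation C := R[i].
Local Notation N := (kyfan p k A).

Definition dualsum (V : 'M[C]_(n, k)) (X : 'M[C]_(m, n)) : C :=
  \sum_(i < k) (sigma A i `^ (p - 2))%:C * inner (X *m col i V) (A *m col i V).

Lemma dualsumDZ V X Y a : dualsum V (X + a *: Y) = dualsum V X + a * dualsum V Y.
Proof.
rewrite /dualsum mulr_sumr -big_split; apply: eq_bigr => i _ /=.
by rewrite mulmxDl -scalemxAl innerDl innerZl; ring.
Qed.

Lemma right_singular_col (V : 'M[C]_(n, k)) i : right_singular A V ->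
  gram A *m col i V = (sigma A (nat_of_ord i) ^+ 2)%:C *: col i V.
Proof.
move=> [_ HV]; rewrite colE mulmxA HV -mulmxA.
rewrite scalemxAr; congr (_ *m _); apply/colP => j.
rewrite mul_diag_mx !mxE; case: eqP => [->//|_].
by rewrite !mulr0.
Qed.

(** The self-adjoint power moves to the second argument, where v_i is an eigenvector of it for the
    eigenvalue sigma_i^(p-2). *)
Lemma psd_sum_dualsum V X : right_singular A V ->
  \sum_(i < k) inner (psd_pow (gram A) ((p - 2) / 2) *m (A ^t* *m X) *m col i V)
                     (col i V) = dualsum V X.
Proof.
move=> HV; apply: eq_bigr => i _; rewrite -mulmxA inner_mulmxl psd_pow_herm.
rewrite (psd_pow_gram _ (right_singular_col i HV)) innerZr conjC_real.
by rewrite sqr_powR_half ?sigma_ge0// -mulmxA inner_mulmxl trmxCK.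
Qed.

Lemma powR_pred2 (s : R) : 0 <= s -> s `^ (p - 2) * s = s `^ (p - 1).
Proof.
move=> s0; have -> : p - 2 = p - 1 - 1 by ring.
by rewrite powR_pred// lt0r_neq0//; move: p2; lra.
Qed.

Lemma dualsum_self V : right_singular A V -> dualsum V A = (N `^ p)%:C.
Proof.
move=> HV; rewrite kyfan_powR; last by move: p2; lra.
rewrite rmorph_sum; apply: eq_bigr => i _.
rewrite inner_nsq (right_singular_nsq _ HV) -rmorphM /=; congr _%:C.
have s0 := sigma_ge0 A i; rewrite expr2 mulrA powR_pred2// powR_pred//.
by rewrite lt0r_neq0//; move: p2; lra.
Qed.

Hypothesis A0 : A != 0.

Lemma dualsum_le V X : right_singular A V ->
  `|dualsum V X| <= (N `^ (p - 1) * kyfan p k X)%:C.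
Proof.
move=> HV; have p0 : 0 < p by move: p2; lra.
pose y i := Num.sqrt (nsq (X *m col i V)).
apply: (@le_trans _ _ (\sum_(i < k) sigma A i `^ (p - 1) * y i)%:C); last first.
  rewrite lecR; apply: holder_sum; rewrite ?kyfan_gt0 ?kyfan_ge0//.
  - by move: p2; lra.
  - by move=> i; apply: sigma_ge0.
  - by move=> i; apply: sqrtr_ge0.
  - by rewrite kyfan_powR.
  - apply: le_trans (kyfan_sum_le X kn p2 HV.1); apply: ler_sum => i _.
    by rewrite -sqr_powR_half ?sqrtr_ge0// sqr_sqrtr ?nsq_ge0.
rewrite rmorph_sum; apply: le_trans (ler_norm_sum _ _ _) _.
apply: ler_sum => i _; have s0 := sigma_ge0 A i.
rewrite normrM ger0_norm ?ler0c ?powR_ge0// -powR_pred2// -mulrA rmorphM /=.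
apply: ler_wpM2l; first by rewrite ler0c powR_ge0.
apply: le_trans (cauchy_schwarz_sqrt _ _) _.
by rewrite (right_singular_nsq _ HV) sqrtr_sqr ger0_norm// mulrC.
Qed.

Lemma birkhoff_eps_dualsum V B (eps : R) : 0 <= eps -> right_singular A V ->
  `|dualsum V B| <= (N `^ (p - 1) * (eps * kyfan p k B))%:C ->
  birkhoff_eps (kyfan p k) eps A B.
Proof.
move=> e0 HV hB lam; rewrite kyfanZ//; set l := complex.Re `|lam|.
have l0 : 0 <= l by rewrite -ler0c normC_Re.
have Npos : 0 < N by apply: kyfan_gt0.
have Np : 0 < N `^ (p - 1) by apply: powR_gt0.
have : N - eps * (l * kyfan p k B) <= kyfan p k (A + lam *: B).
  rewrite -(ler_pM2l Np) -lecR; apply: le_trans (dualsum_le _ HV).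
  rewrite dualsumDZ dualsum_self// mulrBr powR_pred ?(ltW Npos)//; last first.
    by rewrite lt0r_neq0//; move: p2; lra.
  apply: le_trans (lerB_normD _ _); rewrite rmorphB /= ger0_norm ?ler0c ?powR_ge0//.
  rewrite lerD2l lerN2 normrM -normC_Re -/l.
  apply: le_trans (ler_wpM2l _ hB) _; first by rewrite ler0c.
  by rewrite -rmorphM /= lecR le_eqVlt; apply/orP; left; apply/eqP; ring.
have b0 : 0 <= l * kyfan p k B by rewrite mulr_ge0 ?kyfan_ge0.
have eb0 : 0 <= eps * (l * kyfan p k B) by rewrite mulr_ge0.
rewrite [2 * eps * N]mulrAC -(mulrA (2 * N)).
move: eb0 (kyfan_ge0 p k (A + lam *: B)) Npos.
move: (eps * _) (kyfan _ _ (A + _)) N => x M L x0 M0 L0 h.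
(* From L - x <= M to L^2 - 2 L x <= M^2: square when x <= L; otherwise the left-hand side is
   already negative. *)
have [h1|h1] := leP x L.
  have : (L - x) ^+ 2 <= M ^+ 2 by rewrite ler_sqr ?nnegrE ?subr_ge0.
  by apply: le_trans; rewrite sqrrB -[L * x *+ 2]mulr_natl mulrA lerDl sqr_ge0.
apply: le_trans (sqr_ge0 M); rewrite subr_le0 expr2 mulrAC ler_pM2r//; lra.
Qed.

End DualFunctional.

(** * The numerical range of a pair of vectors and commuting singular value decompositions *)

Lemma comm_linear_comb (F : comNzRingType) k (X Y : 'M[F]_k) a b :
  X *m Y = Y *m X -> (X + a *: Y) *m (X + b *: Y) = (X + b *: Y) *m (X + a *: Y).
Proof.
move=> XY; rewrite !mulmxDl !mulmxDr -!scalemxAl -!scalemxAr XY !scalerA.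
by rewrite (mulrC a) -!addrA; congr (_ + _); rewrite addrCA.
Qed.

Section Convexity.
Variable R : realType.
Local Notation C := R[i].

Lemma quadratic_root (a b c : R) : 0 < a -> 0 <= c ->
  exists r, a * r ^+ 2 + b * r = c.
Proof.
move=> a0 c0; pose D := b ^+ 2 + 4 * a * c.
have D0 : 0 <= D by rewrite addr_ge0 ?sqr_ge0// !mulr_ge0// ltW.
exists ((Num.sqrt D - b) / (2 * a)).
have := sqr_sqrtr D0; move: (Num.sqrt D) => s; rewrite /D => hs.
have -> : a * ((s - b) / (2 * a)) ^+ 2 + b * ((s - b) / (2 * a)) =
  (s ^+ 2 - b ^+ 2) / (4 * a) by field; rewrite gt_eqF.
by rewrite hs; field; rewrite gt_eqF.
Qed.

(** The imaginary part of the combination is a real linear form in the two coordinates of w, so it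
    has a nonzero kernel vector: (q1 - p1, p2 + q2), or (1, 0) when this one vanishes. *)
Lemma exists_real_combination (p q : C) : exists w : C,
  0 < sqn w /\ exists g : R, w * p + Num.conj w * q = g%:C.
Proof.
case: p q => [p1 p2] [q1 q2].
pose c := if (p2 + q2 == 0) && (p1 - q1 == 0) then 1 else q1 - p1.
have h : c * (p2 + q2) + (p2 + q2) * (p1 - q1) = 0.
  by rewrite /c; case: ifP => [/andP[/eqP-> _]|_]; ring.
exists (Complex c (p2 + q2)); split.
  rewrite /sqn /= lt_neqAle addr_ge0 ?sqr_ge0// andbT eq_sym.
  rewrite paddr_eq0 ?sqr_ge0// !sqrf_eq0 /c.
  case: ifPn => [_|]; first by rewrite oner_eq0.
  by rewrite andbC -opprB oppr_eq0.
exists (c * (p1 + q1) + (p2 + q2) * (q2 - p2)).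
apply/eqP; rewrite eq_complex; apply/andP; split; apply/eqP => /=; first by ring.
by rewrite -[RHS]h; ring.
Qed.

Lemma toeplitz_hausdorff n (M : 'M[C]_n) (x y : 'cV[C]_n) (t : R) :
  inner x x = 1 -> inner y y = 1 -> 0 <= t <= 1 ->
  exists a b, let z := a *: x + b *: y in inner z z = 1 /\
    inner (M *m z) z = (1 - t)%:C * inner (M *m x) x + t%:C * inner (M *m y) y.
Proof.
move=> x1 y1 /andP[t0 t1]; set al := inner (M *m x) x; set be := inner (M *m y) y.
have [ab|ab] := eqVneq al be.
  exists 1, 0; rewrite /= scale1r scale0r addr0 -/al -ab; split=> //.
  by rewrite -mulrDl -rmorphD /= subrK mul1r.
have [->|t1'] := eqVneq t 1.
  exists 0, 1; rewrite /= scale1r scale0r add0r -/be; split=> //.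
  by rewrite subrr mul0r add0r mul1r.
have bea : be - al != 0 by rewrite subr_eq0 eq_sym.
pose P := inner (M *m y) x; pose Q := inner (M *m x) y; pose e := inner y x.
(* The affine map sending al to 0 and be to 1 reduces the problem to the real segment [0, 1]; the
   phase of w makes the cross terms equal to a real number g. *)
have [w [w0 [g hg]]] := exists_real_combination ((P - al * e) / (be - al))
  ((Q - al * Num.conj e) / (be - al)).
have [W WE] : exists W, W%:C = Num.conj w * w by exists (sqn w); rewrite conjM_sqn.
have W0 : 0 < W by move: WE; rewrite conjM_sqn => /complexI->.
pose h := complex.Re (w * e).
(* In these coordinates the normalized value at x + r w y is (r^2 W + r g) / (1 + r^2 W + 2 r h).
   Equating it with t gives this quadratic, whose leading coefficient is positive because t < 1. *)
have [r hr] : exists r, (1 - t) * W * r ^+ 2 + (g - 2 * t * h) * r = t.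
  apply: quadratic_root => //; rewrite mulr_gt0// subr_gt0 lt_neqAle t1'//.
pose z := x + (r%:C * w) *: y.
pose L := 1 + r ^+ 2 * W + 2 * r * h.
have we : w * e + Num.conj w * Num.conj e = 2 * h%:C.
  by rewrite -rmorphM; exact: addcJ.
have LE : L%:C = 1 + r%:C ^+ 2 * W%:C + 2 * r%:C * h%:C.
  by rewrite /L rmorphD rmorphD !rmorphM /= rmorph_nat; ring.
have zz : inner z z = L%:C.
  rewrite /z innerDl !innerDr !innerZl !innerZr x1 y1 -(inner_conj y x) -/e.
  rewrite rmorphM /= conjC_real LE WE.
  transitivity (1 + r%:C ^+ 2 * (Num.conj w * w) + r%:C * (w * e + Num.conj w * Num.conj e)).
    by ring.
  by rewrite we; ring.
have Mz : inner (M *m z) z = (al + (be - al) * t%:C) * L%:C.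
  have E1 : inner (M *m z) z = al + r%:C * (w * P + Num.conj w * Q) + r%:C ^+ 2 * W%:C * be.
    rewrite /z mulmxDr -scalemxAr innerDl !innerDr !innerZl !innerZr.
    rewrite -/al -/be -/P -/Q rmorphM /= conjC_real WE; ring.
  have E2 : w * P + Num.conj w * Q = (be - al) * g%:C + al * (2 * h%:C).
    rewrite -hg -we; field.
    by rewrite bea.
  have E3 : r%:C ^+ 2 * W%:C + r%:C * g%:C = t%:C * L%:C.
    rewrite -!rmorphXn -!rmorphM -rmorphD; congr _%:C.
    transitivity (t * L + ((1 - t) * W * r ^+ 2 + (g - 2 * t * h) * r - t)).
      by rewrite /L; ring.
    by rewrite hr subrr addr0.
  rewrite E1 E2; transitivity (al * L%:C + (be - al) * (t%:C * L%:C)); last by ring.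
  by rewrite -E3 LE; ring.
(* If z were 0, then x would be a unimodular multiple of y, which forces al = be. *)
have L0 : 0 < L.
  have : nsq z = L by apply: complexI; rewrite -inner_nsq.
  move=> zL; rewrite -zL lt_neqAle nsq_ge0 andbT; apply/eqP => /esym/nsq_eq0.
  move=> /eqP; rewrite addr_eq0 -scaleNr => /eqP xy.
  move/eqP: ab; apply.
  have c1 : - (r%:C * w) * Num.conj (- (r%:C * w)) = 1.
    by have := x1; rewrite xy innerZl innerZr y1 mulr1.
  by rewrite /al xy -scalemxAr innerZl innerZr -/be mulrA c1 mul1r.
exists ((Num.sqrt L)^-1)%:C, (((Num.sqrt L)^-1 * r)%:C * w) => /=.
set z' := _ + _; have -> : z' = ((Num.sqrt L)^-1)%:C *: z.
  by rewrite /z' /z scalerDr scalerA rmorphM mulrA.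
rewrite -scalemxAr !innerZl !innerZr conjC_real zz Mz.
have sL : (Num.sqrt L)^-1%:C * ((Num.sqrt L)^-1%:C * L%:C) = 1.
  rewrite -!rmorphM -[X in _ * (_ * X)](sqr_sqrtr (ltW L0)); congr _%:C.
  by field; rewrite gt_eqF// sqrtr_gt0.
split=> //; rewrite [_ * L%:C]mulrC !mulrA -[_ * _ * L%:C]mulrA sL mul1r.
by rewrite rmorphB /=; ring.
Qed.

Definition diagonal k (D : 'M[C]_k) : Prop := forall i j, i != j -> D i j = 0.

Lemma diagonal_comm k (D E : 'M[C]_k) : diagonal D -> diagonal E -> D *m E = E *m D.
Proof.
move=> dD dE; apply/matrixP => i j; rewrite !mxE.
have [->|ij] := eqVneq i j.
  by apply: eq_bigr => l _; have [->|lj] := eqVneq l j;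
    [rewrite mulrC | rewrite !(dD, dE) ?mul0r// 1?eq_sym].
rewrite !big1// => l _; have [lj|lj] := eqVneq l j.
- by rewrite lj dE// mul0r.
- by rewrite (dD l j)// mulr0.
- by rewrite lj dD// mul0r.
- by rewrite (dE l j)// mulr0.
Qed.

(** Were every e/(j+1) the negative of an eigenvalue of K, the characteristic polynomial, of degree
    k, would have k+1 distinct roots. *)
Lemma shift_unitmx k (K : 'M[C]_k) (e : R) : 0 < e ->
  exists d : R, 0 < d <= e /\ K + d%:C%:M \in unitmx.
Proof.
move=> e0; pose f (j : nat) : R := e / j.+1%:R.
have fb j : 0 < f j <= e.
  rewrite divr_gt0//= ler_pdivrMr// ler_peMr ?(ltW e0)//.
  by rewrite ler1n.
have [|nex] := pselect (exists j, K + (f j)%:C%:M \in unitmx).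
  by move=> [j hj]; exists (f j).
have rt j : root (char_poly K) (- (f j)%:C).
  rewrite -eigenvalue_root_char /eigenvalue /eigenspace kermx_eq0 row_free_unit.
  by apply/negP => hj; apply: nex; exists j; rewrite raddfN opprK in hj.
have := @max_poly_roots _ (char_poly K) [seq - (f j)%:C | j <- iota 0 k.+1].
rewrite size_char_poly size_map size_iota ltnn => h; exfalso.
suff : false by []; apply: h.
- by rewrite -size_poly_gt0 size_char_poly.
- by apply/allP => _ /mapP[j _ ->].
- rewrite map_inj_uniq ?iota_uniq// => i j /oppr_inj/complexI/(mulfI (lt0r_neq0 e0)).
  by move=> /invr_inj/eqP; rewrite eqr_nat => /eqP[].
Qed.

(** Right singular vectors of K are chosen among eigenvectors of S. Their images under K,
    normalized, are the left singular vectors and keep the same S-eigenvalues because K commutes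
    with S; hence one D for both P and Q. *)
Lemma commuting_svd_unit k (S K : 'M[C]_k) : K \in unitmx -> S ^t* = S ->
  S *m K = K *m S -> exists P Q D : 'M[C]_k,
  [/\ P ^t* *m P = 1%:M, Q ^t* *m Q = 1%:M,
      [/\ diagonal D, S *m P = P *m D & S *m Q = Q *m D]
    & diagonal (Q ^t* *m K *m P)].
Proof.
move=> Ku Sh SK; pose G := K ^t* *m K.
have Gh : G ^t* = G by rewrite /G adjmxM trmxCK.
have SG : S *m G = G *m S.
  have := congr1 (fun X => X ^t*) SK; rewrite !adjmxM Sh => h.
  by rewrite /G mulmxA -h -!mulmxA SK.
(* Two commuting Hermitian matrices are the real and imaginary parts of a normal matrix, so one
   unitary diagonalization serves for both. *)
pose N := G + 'i%C *: S.
have Nh : N ^t* = G + (- 'i%C) *: S.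
  rewrite /N adjmxD adjmxZ Gh Sh; congr (_ + _ *: _).
  by apply/eqP; rewrite eq_complex /= oppr0 !eqxx.
have /orthomx_spectralP : N \is normalmx.
  by apply/normalmxP; rewrite Nh; apply: comm_linear_comb.
set U := spectralmx N; set d := spectral_diag N.
have Uu : U \is unitarymx by apply: spectral_unitarymx.
rewrite invmx_unitary// => NE; pose P := U ^t*.
have UU : U *m U ^t* = 1%:M by apply/unitarymxP.
have PP : P ^t* *m P = 1%:M by rewrite /P trmxCK.
have NP : N *m P = P *m diag_mx d by rewrite NE -!mulmxA UU mulmx1.
have NhP : N ^t* *m P = P *m (diag_mx d) ^t*.
  by rewrite NE !adjmxM trmxCK -!mulmxA UU mulmx1.
(* Imaginary and real parts of the eigenvalues of N, that is, the eigenvalues of S and of G. *)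
pose D := (- 'i%C / 2) *: (diag_mx d - (diag_mx d) ^t*).
pose E := 2^-1 *: (diag_mx d + (diag_mx d) ^t*).
have SP : S *m P = P *m D.
  rewrite /D -scalemxAr mulmxBr -NP -NhP -mulmxBl scalemxAl; congr (_ *m _).
  rewrite Nh /N opprD addrACA subrr add0r scaleNr opprK -scalerDl scalerA.
  rewrite (_ : _ * _ = 1) ?scale1r//; transitivity (- ('i%C ^+ 2) : C); first by field.
  by rewrite sqr_i opprK.
have GP : G *m P = P *m E.
  rewrite /E -scalemxAr mulmxDr -NP -NhP -mulmxDl scalemxAl; congr (_ *m _).
  rewrite Nh /N addrACA scaleNr subrr addr0 -mulr2n -[G *+ 2]scaler_nat scalerA.
  by rewrite mulVf ?pnatr_eq0// scale1r.
have dg : diagonal D.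
  by move=> i j ij; rewrite !mxE (negPf ij) eq_sym (negPf ij) !mulr0n conjC0 subr0 mulr0.
have eg : diagonal E.
  by move=> i j ij; rewrite !mxE (negPf ij) eq_sym (negPf ij) !mulr0n conjC0 addr0 mulr0.
pose l j := nsq (K *m col j P).
have PGP : P ^t* *m G *m P = diag_mx (\row_j (l j)%:C).
  apply/matrixP => i j; have [->|ij] := eqVneq i j.
    by rewrite quadmxE /G -mulmxA inner_mulmxl trmxCK inner_nsq !mxE eqxx mulr1n.
  by rewrite -mulmxA GP mulmxA PP mul1mx eg// !mxE (negPf ij) mulr0n.
(* Invertibility of K enters here: the columns of K P can be normalized. *)
have l0 j : 0 < l j.
  rewrite lt_neqAle nsq_ge0 andbT; apply/eqP => /esym/nsq_eq0 h.
  have := congr1 (mulmx (invmx K)) h; rewrite mulKmx// mulmx0 => h'.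
  have /matrixP/(_ j j) := PP; rewrite adjmx_mulE h' /inner mulmx0 !mxE eqxx.
  by move=> /esym/eqP; rewrite oner_eq0.
pose F := diag_mx (\row_j ((Num.sqrt (l j))^-1)%:C) : 'M[C]_k.
have Fh : F ^t* = F by apply: adj_diag_real.
have PKKP q (X : 'M_(k, q)) :
    P ^t* *m (K ^t* *m (K *m (P *m X))) = diag_mx (\row_j (l j)%:C) *m X.
  by rewrite -PGP /G !mulmxA.
exists P, (K *m P *m F), D; split; [exact: PP| |split; [exact: dg|exact: SP|]|].
- rewrite !adjmxM Fh -!mulmxA PKKP /F !mulmx_diag -diag_const_mx.
  congr diag_mx; apply/rowP => j; rewrite !mxE -!rmorphM /=.
  suff -> : (Num.sqrt (l j))^-1 * (l j * (Num.sqrt (l j))^-1) = 1 by [].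
  rewrite -{2}(sqr_sqrtr (ltW (l0 j))); field.
  by rewrite gt_eqF// sqrtr_gt0.
- rewrite !mulmxA SK -(mulmxA K S) SP !mulmxA -!(mulmxA (K *m P)).
  by congr (_ *m _); apply: diagonal_comm; [exact: dg|move=> i j ij; rewrite !mxE (negPf ij) mulr0n].
- rewrite !adjmxM Fh -!mulmxA -[K *m P]mulmx1 -(mulmxA K) PKKP.
  by rewrite mulmx1 /F mulmx_diag => i j ij; rewrite !mxE (negPf ij) mulr0n.
Qed.

End Convexity.

(** * Convexity of the k-numerical range *)

Section NumericalRange.
Variable R : realType.
Local Notation C := R[i].
Local Open Scope classical_set_scope.

Lemma exists_ultrafilter : exists2 F : set_system nat, UltraFilter F & \oo `<=` F.
Proof.
have [F [UF h]] := @ultraFilterLemma nat \oo _.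
by exists F.
Qed.

Lemma cvg_ultra_harmonic (F : set_system nat) : UltraFilter F -> \oo `<=` F ->
  (n.+1%:R^-1 : R) @[n --> F] --> (0 : R).
Proof. by move=> UF Foo V V0; apply: Foo; exact: (@cvg_harmonic R V V0). Qed.

Lemma isometry_entry_le1 n k (V : 'M[C]_(n, k)) i j : V ^t* *m V = 1%:M ->
  `|V i j| <= 1.
Proof.
move=> VV; have : sqn (V i j) <= 1.
  apply: le_trans (isometry_row_le1 i VV).
  by rewrite (bigD1 j)//= lerDl sumr_ge0// => l _; apply: sqn_ge0.
rewrite -sqn_Re_norm expr_le1//; last by rewrite -ler0c normC_Re.
by rewrite -(normC_Re (V i j)) => h; rewrite (lecR _ 1).
Qed.

Lemma mxcvg_isometry (F : set_system nat) n k (V : nat -> 'M[C]_(n, k)) W :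
  ProperFilter F -> (forall t, V t ^t* *m V t = 1%:M) -> mxcvg F V W ->
  W ^t* *m W = 1%:M.
Proof.
move=> FF VV VW; have := mxcvgM FF (mxcvg_adj FF VW) VW => h.
apply: mxcvg_unique h _; under eq_fun do rewrite VV; exact: mxcvg_cst.
Qed.

Lemma mxcvg_diagonal (F : set_system nat) k (D : nat -> 'M[C]_k) E :
  ProperFilter F -> (forall t, diagonal (D t)) -> mxcvg F D E -> diagonal E.
Proof.
move=> FF dD DE i j ij; have h := DE i j; apply: ccvg_unique h _.
under eq_fun do rewrite dD//; exact: ccvg_cst.
Qed.

(** For singular K some column of K P may vanish and cannot be normalized. Small scalar shifts of K
    are invertible and still commute with S; their isometries are bounded, and all the conditions
    survive a limit. *)
Lemma commuting_svd k (S K : 'M[C]_k) : S ^t* = S ->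
  S *m K = K *m S -> exists P Q D : 'M[C]_k,
  [/\ P ^t* *m P = 1%:M, Q ^t* *m Q = 1%:M,
      [/\ diagonal D, S *m P = P *m D & S *m Q = Q *m D]
    & diagonal (Q ^t* *m K *m P)].
Proof.
move=> Sh SK.
have step (t : nat) : exists W : 'M[C]_k * 'M[C]_k * 'M[C]_k * R,
    let: (P, Q, D, d) := W in
  [/\ P ^t* *m P = 1%:M, Q ^t* *m Q = 1%:M,
      [/\ diagonal D, S *m P = P *m D & S *m Q = Q *m D]
    & diagonal (Q ^t* *m (K + d%:C%:M) *m P) /\ 0 < d <= t.+1%:R^-1].
  have [|d [d0 Kd]] := @shift_unitmx _ _ K (t.+1%:R^-1); first by rewrite invr_gt0.
  have [|P [Q [D [h1 h2 h3 h4]]]] := commuting_svd_unit Kd Sh.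
    by rewrite mulmxDl mulmxDr SK scalar_mxC.
  by exists (P, Q, D, d).
have [W hW] := choice step.
have [F UF Foo] := exists_ultrafilter; have FF := @ultra_proper _ _ UF.
pose P t := (W t).1.1.1; pose Q t := (W t).1.1.2; pose D t := (W t).1.2.
pose d t := (W t).2.
have {}hW t : [/\ P t ^t* *m P t = 1%:M, Q t ^t* *m Q t = 1%:M,
      [/\ diagonal (D t), S *m P t = P t *m D t & S *m Q t = Q t *m D t]
    & diagonal (Q t ^t* *m (K + (d t)%:C%:M) *m P t) /\ 0 < d t <= t.+1%:R^-1].
  by rewrite /P /Q /D /d; have := hW t; case: (W t) => [[[]]].
have PP t : P t ^t* *m P t = 1%:M by case: (hW t).
have QQ t : Q t ^t* *m Q t = 1%:M by case: (hW t).
have [P' hP] : exists P', mxcvg F P P'.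
  by apply: ultra_mx => // t i j; apply: isometry_entry_le1.
have [Q' hQ] : exists Q', mxcvg F Q Q'.
  by apply: ultra_mx => // t i j; apply: isometry_entry_le1.
have hd : mxcvg F (fun t => (d t)%:C%:M : 'M[C]_k) 0.
  have d0 : d t @[t --> F] --> (0 : R).
    apply: (squeeze_cvgr _ (cvg_cst 0) (cvg_ultra_harmonic UF Foo)).
    by apply: nearW => t; have [_ _ _ [_ /andP[/ltW-> ->]]] := hW t.
  rewrite -[0 : 'M_k](scale0r 1%:M); under eq_fun do rewrite -scalemx1.
  by apply: mxcvgZ => //; [exact: (ccvg_real _ d0) | exact: mxcvg_cst].
(* No separate bound on D is needed, since it is determined by P through D = P^* S P. *)
have hD : mxcvg F D (P' ^t* *m S *m P').
  have -> : D = fun t => P t ^t* *m S *m P t.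
    apply/funext => t; have [_ _ [_ h _] _] := hW t.
    by rewrite -mulmxA h mulmxA PP mul1mx.
  by apply: mxcvgM => //; apply: mxcvgM => //; [exact: mxcvg_adj | exact: mxcvg_cst].
exists P', Q', (P' ^t* *m S *m P'); split.
- exact: mxcvg_isometry hP.
- exact: mxcvg_isometry hQ.
- split.
  + by apply: mxcvg_diagonal hD => // t; case: (hW t) => _ _ [].
  + have h1 := mxcvgM FF (mxcvg_cst FF S) hP; have h2 := mxcvgM FF hP hD.
    apply: mxcvg_unique h1 _ => //; move: h2.
    by congr (mxcvg _ _ _); apply/funext => t; case: (hW t) => _ _ [].
  + have h1 := mxcvgM FF (mxcvg_cst FF S) hQ; have h2 := mxcvgM FF hQ hD.
    apply: mxcvg_unique h1 _ => //; move: h2.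
    by congr (mxcvg _ _ _); apply/funext => t; case: (hW t) => _ _ [].
- apply: (@mxcvg_diagonal F _ (fun t => Q t ^t* *m (K + (d t)%:C%:M) *m P t)) => //.
    by move=> t; case: (hW t) => _ _ _ [].
  apply: mxcvgM => //; apply: mxcvgM => //; first exact: mxcvg_adj.
  by rewrite -[X in mxcvg _ _ X]addr0; apply: mxcvgD => //; exact: mxcvg_cst.
Qed.

Lemma isometry_inner n k (V : 'M[C]_(n, k)) i j : V ^t* *m V = 1%:M ->
  inner (col i V) (col j V) = (j == i)%:R.
Proof. by move=> VV; rewrite -adjmx_mulE VV mxE. Qed.

(* Principal vectors of the two column spaces span mutually orthogonal planes,
   in each of which the numerical range is convex. *)
Lemma numerical_range_convex n k (H M : 'M[C]_n) (S : 'M[C]_k) (V V' : 'M[C]_(n, k))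
    (t : R) : H ^t* = H -> S ^t* = S ->
  V ^t* *m V = 1%:M -> V' ^t* *m V' = 1%:M ->
  H *m V = V *m S -> H *m V' = V' *m S -> 0 <= t <= 1 ->
  exists Z : 'M_(n, k), [/\ Z ^t* *m Z = 1%:M, H *m Z = Z *m S &
    \tr (Z ^t* *m M *m Z) =
      (1 - t)%:C * \tr (V ^t* *m M *m V) + t%:C * \tr (V' ^t* *m M *m V')].
Proof.
move=> Hh Sh VV VV' HV HV' t01; pose K := V' ^t* *m V.
(* Both sides equal V'^* H V. *)
have SK : S *m K = K *m S.
  rewrite /K mulmxA -{1}Sh -adjmxM -HV' adjmxM Hh -!mulmxA -HV //.
have [P [Q [D [PP QQ [dD SP SQ] dK]]]] := commuting_svd Sh SK.
have PP' := mulmx1C PP; have QQ' := mulmx1C QQ.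
pose X := V *m P; pose Y := V' *m Q.
have XX : X ^t* *m X = 1%:M.
  by rewrite /X adjmxM -mulmxA (mulmxA (V ^t*)) VV mul1mx.
have YY : Y ^t* *m Y = 1%:M.
  by rewrite /Y adjmxM -mulmxA (mulmxA (V' ^t*)) VV' mul1mx.
have dYX : diagonal (Y ^t* *m X).
  by move: dK; rewrite /X /Y /K adjmxM !mulmxA.
have HX : H *m X = X *m D by rewrite /X mulmxA HV -!mulmxA SP.
have HY : H *m Y = Y *m D by rewrite /Y mulmxA HV' -!mulmxA SQ.
have trX : \tr (V ^t* *m M *m V) = \tr (X ^t* *m M *m X).
  rewrite /X adjmxM -!mulmxA [RHS]mxtrace_mulC -!mulmxA PP' mulmx1 //.
have trY : \tr (V' ^t* *m M *m V') = \tr (Y ^t* *m M *m Y).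
  rewrite /Y adjmxM -!mulmxA [RHS]mxtrace_mulC -!mulmxA QQ' mulmx1 //.
clearbody X Y.
have xi i : inner (col i X) (col i X) = 1 by rewrite isometry_inner// eqxx.
have yi i : inner (col i Y) (col i Y) = 1 by rewrite isometry_inner// eqxx.
have th i := toeplitz_hausdorff M (xi i) (yi i) t01.
have [a ha] := choice th; have [b hb] := choice ha.
pose Z := X *m diag_mx (\row_i a i) + Y *m diag_mx (\row_i b i).
have colZ i : col i Z = a i *: col i X + b i *: col i Y.
  by apply/colP => j; rewrite /Z !mul_mx_diag !mxE mulrC [b i * _]mulrC.
have ZZ : Z ^t* *m Z = 1%:M.
  apply/matrixP => i j; rewrite adjmx_mulE mxE.
  have [->|ij] := eqVneq i j; first by rewrite colZ; case: (hb j).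
  rewrite !colZ innerDl !innerDr !innerZl !innerZr !isometry_inner//.
  have -> : inner (col j X) (col i Y) = 0 by rewrite -adjmx_mulE dYX.
  have -> : inner (col j Y) (col i X) = 0.
    by rewrite -inner_conj -adjmx_mulE dYX ?rmorph0// eq_sym.
  by rewrite (negPf ij) !mulr0 !addr0.
have HZ : H *m Z = Z *m D.
  have dc (c : 'I_k -> C) : diag_mx (\row_i c i) *m D = D *m diag_mx (\row_i c i).
    by apply: diagonal_comm => // i j ij; rewrite !mxE (negPf ij) mulr0n.
  by rewrite /Z mulmxDr mulmxDl !mulmxA HX HY -!mulmxA !dc.
have PS : P ^t* *m S = D *m P ^t*.
  by rewrite -[LHS]mulmx1 -PP' -!mulmxA (mulmxA S) SP !mulmxA PP mul1mx.
(* Z satisfies the constraint with D in place of S; multiplying by P^* restores S and leaves the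
   trace unchanged. *)
exists (Z *m P ^t*); split.
- by rewrite adjmxM trmxCK -mulmxA (mulmxA (Z ^t*)) ZZ mul1mx.
- by rewrite mulmxA HZ -!mulmxA PS.
rewrite trX trY adjmxM trmxCK -!mulmxA [LHS]mxtrace_mulC -!mulmxA PP mulmx1.
rewrite /mxtrace !mulr_sumr -big_split; apply: eq_bigr => i _ /=.
by rewrite !mulmxA !quadmxE colZ; case: (hb i).
Qed.

End NumericalRange.

(** * Limits of singular vectors *)

Section SingularLimits.
Variable R : realType.
Local Notation C := R[i].
Local Open Scope classical_set_scope.

Variables (F : set_system nat) (UF : UltraFilter F).
Let FF : ProperFilter F := @ultra_proper _ _ UF.

Lemma ccvg_Re z (a : C) : ccvg F z a -> complex.Re (z t) @[t --> F] --> complex.Re a.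
Proof. by case. Qed.

Lemma mxcvg_col n k V (W : 'M[C]_(n, k)) i :
  mxcvg F V W -> mxcvg F (fun t => col i (V t)) (col i W).
Proof. by move=> h a b; rewrite mxE; under eq_fun do rewrite mxE; exact: h. Qed.

Lemma ccvg_inner n x y (a b : 'cV[C]_n) : mxcvg F x a -> mxcvg F y b ->
  ccvg F (fun t => inner (x t) (y t)) (inner a b).
Proof. by move=> xa yb; apply: mxcvgM => //; exact: mxcvg_adj. Qed.

Lemma cvg_nsq n x (a : 'cV[C]_n) : mxcvg F x a -> nsq (x t) @[t --> F] --> nsq a.
Proof. by move=> xa; apply: ccvg_Re; apply: ccvg_inner. Qed.

Lemma cvg_sumr (I : Type) (r : seq I) (f : I -> nat -> R) (a : I -> R) :
  (forall i, f i t @[t --> F] --> a i) ->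
  \sum_(i <- r) f i t @[t --> F] --> \sum_(i <- r) a i.
Proof.
move=> h; elim: r => [|i r ih].
  by rewrite big_nil; under eq_fun do rewrite big_nil; exact: cvg_cst.
by rewrite big_cons; under eq_fun do rewrite big_cons; exact: cvgD.
Qed.

Lemma sum_nsq_le m n k (X : 'M[C]_(m, n)) (V : 'M_(n, k)) :
  (k <= n)%N -> V ^t* *m V = 1%:M ->
  \sum_i nsq (X *m col i V) <= \sum_(i < k) sigma X i ^+ 2.
Proof.
case: k V => [V _ _|k V kn VV]; first by rewrite !big_ord0.
have := @kyfan_le _ _ _ _ X V 1 kn (lexx _) VV.
by under eq_bigr do rewrite powRr1 ?nsq_ge0//;
   under [X in _ <= X]eq_bigr do rewrite powRr1 ?sqr_ge0//.
Qed.

(** The limits mu_i of the squared singular values are the squared lengths of A on the limit basis.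
    Their partial sums are bounded above by Ky Fan's inequality for A on that basis, and below by
    the limit of the same inequality for X_t on singular vectors of A. Equality of all partial sums
    gives equality of the terms. *)
Lemma right_singular_cvg m n (X : nat -> 'M[C]_(m, n)) (E : nat -> 'M[C]_n) A E' :
  mxcvg F X A -> (forall t, right_singular (X t) (E t)) -> mxcvg F E E' ->
  right_singular A E' /\
  forall i, (i < n)%N -> sigma (X t) i ^+ 2 @[t --> F] --> sigma A i ^+ 2.
Proof.
move=> XA RS EE'.
have iso : E' ^t* *m E' = 1%:M by apply: mxcvg_isometry EE' => // t; case: (RS t).
have GA : mxcvg F (fun t => gram (X t)) (gram A).
  by apply: mxcvgM => //; exact: mxcvg_adj.
(* Extended by 0 beyond n, so that partial sums of any length j can be written over ['I_j]. *)
pose mu i : R := if insub i is Some j then nsq (A *m col j E') else 0.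
have muE (j : 'I_n) : mu j = nsq (A *m col j E') by rewrite /mu valK.
have cvgmu (j : 'I_n) : sigma (X t) j ^+ 2 @[t --> F] --> mu j.
  rewrite muE; under eq_fun => t do rewrite -(right_singular_nsq j (RS t)).
  by apply: cvg_nsq; apply: mxcvgM => //; exact: mxcvg_col.
have sum_le j (jn : (j <= n)%N) : \sum_(i < j) mu i <= \sum_(i < j) sigma A i ^+ 2.
  pose V := first_cols jn E'.
  have VV : V ^t* *m V = 1%:M.
    apply: (@mxcvg_isometry _ F _ _ (fun t => first_cols jn (E t))) => //.
      by move=> t; case: (right_singular_first_cols jn (RS t)).
    by move=> a b; rewrite mxE; under eq_fun do rewrite mxE; exact: EE'.
  apply: le_trans (sum_nsq_le A jn VV); apply: ler_sum => i _.
  rewrite -[val i]/(val (widen_ord jn i)) muE le_eqVlt; apply/orP; left; apply/eqP.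
  by congr nsq; congr (_ *m _); apply/colP => a; rewrite !mxE.
have sum_ge j (jn : (j <= n)%N) : \sum_(i < j) sigma A i ^+ 2 <= \sum_(i < j) mu i.
  have [V HV] := right_singular_exists A jn.
  rewrite -(eq_bigr _ (fun i _ => right_singular_nsq i HV)).
  apply: (@ler_cvg_to _ F _ _ (fun t => \sum_i nsq (X t *m col i V))
     (fun t => \sum_(i < j) sigma (X t) i ^+ 2)).
  - by apply: cvg_sumr => i; apply: cvg_nsq; apply: mxcvgM => //; exact: mxcvg_cst.
  - by apply: cvg_sumr => i; exact: (cvgmu (widen_ord jn i)).
  - by apply: nearW => t; apply: sum_nsq_le => //; case: HV.
have sumE j (jn : (j <= n)%N) : \sum_(i < j) mu i = \sum_(i < j) sigma A i ^+ 2.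
  by apply/eqP; rewrite eq_le sum_le// sum_ge.
have mus i : (i < n)%N -> mu i = sigma A i ^+ 2.
  move=> i_n; have := sumE i.+1 i_n; rewrite !big_ord_recr /= sumE ?(ltnW i_n)//.
  by move/addrI.
have cvgs i : (i < n)%N -> sigma (X t) i ^+ 2 @[t --> F] --> sigma A i ^+ 2.
  by move=> i_n; rewrite -mus//; exact: (cvgmu (Ordinal i_n)).
split=> //; split=> //.
have h1 : mxcvg F (fun t => gram (X t) *m E t) (gram A *m E') by apply: mxcvgM.
apply: mxcvg_unique h1 _ => //.
under eq_fun => t do rewrite (RS t).2.
apply: mxcvgM => // i j; rewrite !mxE; under eq_fun do rewrite !mxE.
case: eqP => _; last by rewrite !mulr0n; under eq_fun do rewrite mulr0n; exact: ccvg_cst.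
by rewrite !mulr1n; under eq_fun do rewrite mulr1n; apply: ccvg_real; exact: cvgs.
Qed.

Lemma right_singular_closed m n k (A : 'M[C]_(m, n)) (V : nat -> 'M[C]_(n, k)) W :
  (forall t, right_singular A (V t)) -> mxcvg F V W -> right_singular A W.
Proof.
move=> RS VW; split; first by apply: mxcvg_isometry VW => // t; case: (RS t).
have h1 : mxcvg F (fun t => gram A *m V t) (gram A *m W).
  by apply: mxcvgM => //; exact: mxcvg_cst.
apply: mxcvg_unique h1 _ => //; under eq_fun => t do rewrite (RS t).2.
by apply: mxcvgM => //; exact: mxcvg_cst.
Qed.

Lemma right_singular_limit n k m (A : 'M[C]_(m, n)) (V : nat -> 'M[C]_(n, k)) :
  (forall t, right_singular A (V t)) -> exists W, mxcvg F V W.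
Proof.
by move=> RS; apply: ultra_mx => // t i j; apply: isometry_entry_le1; case: (RS t).
Qed.

Lemma ccvg_dualsum m n k (A B : 'M[C]_(m, n)) p (V : nat -> 'M[C]_(n, k)) W :
  mxcvg F V W -> ccvg F (fun t => dualsum A p (V t) B) (dualsum A p W B).
Proof.
move=> VW; apply: ccvg_sum => // i; apply: ccvgM => //; first exact: ccvg_cst.
by apply: ccvg_inner; apply: mxcvgM => //; first [exact: mxcvg_cst | exact: mxcvg_col].
Qed.

End SingularLimits.

(** * Directional derivatives and the theorem *)

(* The tangent inequality bounds the increment of the p-th powers from above by
   derivatives taken at the perturbed values, and that of the norm from below. *)
Lemma tangent_sum_le (R : realType) k (a b c : 'I_k -> R) (p eps N M NB t : R) :
  2 <= p -> 0 < N -> 0 <= M -> 0 < t ->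
  (forall i, 0 <= a i) -> (forall i, 0 <= b i) ->
  N ^+ 2 - 2 * eps * N * (t * NB) <= M ^+ 2 ->
  \sum_i a i `^ (p / 2) = M `^ p -> \sum_i b i `^ (p / 2) <= N `^ p ->
  (forall i, a i - b i = t * c i) ->
  - (2 * (N `^ (p - 1) * (eps * NB))) <= \sum_i a i `^ ((p - 2) / 2) * c i.
Proof.
move=> p2 N0 M0 t0 a0 b0 NM aM bN ab.
have qE : (p - 2) / 2 = p / 2 - 1 by field.
have q1 : 1 <= p / 2 by lra.
have tq : 0 < p / 2 * t by rewrite mulr_gt0//; lra.
(* The tangent of x^(p/2) at N^2, evaluated at M^2, turns the hypothesis on squares into a bound on
   p-th powers. *)
have low : N `^ p - p / 2 * (t * (2 * (N `^ (p - 1) * (eps * NB)))) <= M `^ p.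
  rewrite -(sqr_powR_half p (ltW N0)) -(sqr_powR_half p M0).
  apply: le_trans (powR_tangent q1 (sqr_ge0 N) (sqr_ge0 M)).
  rewrite lerD2l -qE (sqr_powR_half _ (ltW N0)) -(powR_pred2 p2 (ltW N0)).
  have : - (2 * eps * N * (t * NB)) <= M ^+ 2 - N ^+ 2 by rewrite lerBrDl.
  have c0 : 0 <= p / 2 * N `^ (p - 2) by rewrite mulr_ge0 ?powR_ge0//; lra.
  move=> /(ler_wpM2l c0); apply: le_trans; rewrite le_eqVlt; apply/orP; left.
  by apply/eqP; ring.
have up : M `^ p - N `^ p <= p / 2 * (t * \sum_i a i `^ (p / 2 - 1) * c i).
  apply: (@le_trans _ _ (\sum_i (a i `^ (p / 2) - b i `^ (p / 2)))).
    by rewrite sumrB aM lerD2l lerN2.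
  rewrite !mulr_sumr; apply: ler_sum => i _.
  have h := powR_tangent q1 (a0 i) (b0 i).
  rewrite [t * _]mulrCA -ab lerBlDr -lerBlDl; apply: le_trans h.
  by rewrite le_eqVlt; apply/orP; left; apply/eqP; ring.
rewrite -(ler_pM2l tq) qE.
move: low up; rewrite mulrN -!mulrA; lra.
Qed.

Lemma right_singular_sum (R : realType) m n k (X : 'M[R[i]]_(m, n)) (V : 'M_(n, k)) p :
  0 < p -> right_singular X V ->
  \sum_i nsq (X *m col i V) `^ (p / 2) = kyfan p k X `^ p.
Proof.
move=> p0 HV; rewrite [RHS]kyfan_powR//; apply: eq_bigr => i _.
by rewrite (right_singular_nsq _ HV) sqr_powR_half ?sigma_ge0.
Qed.

Lemma nsq_addZ (R : realType) n (a : R[i]) (x y : 'cV[R[i]]_n) :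
  nsq (x + a *: y) = nsq x + sqn a * nsq y + 2 * complex.Re (a * inner y x).
Proof.
apply: complexI; rewrite -[LHS]inner_nsq innerDl !innerDr !innerZl !innerZr !inner_nsq.
rewrite -(inner_conj y x) rmorphD [X in _ = _ + X]rmorphM /= rmorph_nat -addcJ.
rewrite rmorphD [X in _ = _ + X + _]rmorphM /= -conjM_sqn.
rewrite [X in _ = _ + (_ + X)](rmorphM Num.conj); ring.
Qed.

Section Necessity.
Variables (R : realType) (m n k : nat) (A B : 'M[R[i]]_(m, n)) (p eps : R).
Hypotheses (kn : (0 < k <= n)%N) (p2 : 2 <= p) (A0 : A != 0) (e0 : 0 <= eps).
Hypothesis hB : birkhoff_eps (kyfan p k) eps A B.
Local Notation C := R[i].
Local Notation N := (kyfan p k A).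
Local Notation NB := (kyfan p k B).
Local Open Scope classical_set_scope.

(** V belongs to the perturbed matrix X. Hence the sum of powers is exact for X and only bounded by
    the norm for A, which is the direction that an upper bound on the increment requires. *)
Lemma perturbed_le (u : C) (t : R) (X : 'M[C]_(m, n)) (V : 'M[C]_(n, k)) :
  `|u| = 1 -> 0 < t -> X = A + (t%:C * u) *: B -> right_singular X V ->
  - (2 * (N `^ (p - 1) * (eps * NB))) <=
  \sum_(i < k) (sigma X i ^+ 2) `^ ((p - 2) / 2) *
    (2 * complex.Re (u * inner (B *m col i V) (A *m col i V)) +
     t * nsq (B *m col i V)).
Proof.
have p0 : 0 < p by move: p2; lra.
move=> u1 t0 XE HV; have lt : complex.Re `|t%:C * u| = t.
  by rewrite normrM u1 mulr1 ger0_norm ?ler0c ?(ltW t0).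
have sq : sqn (t%:C * u) = t ^+ 2 by rewrite -sqn_Re_norm lt.
have NX := hB (t%:C * u); rewrite kyfanZ// lt -XE in NX.
under eq_bigr do rewrite -(right_singular_nsq _ HV).
have sX := right_singular_sum p0 HV.
have sA := kyfan_sum_le A kn p2 HV.1.
have N0 : 0 < N := kyfan_gt0 p kn A0.
apply: (tangent_sum_le p2 N0 (kyfan_ge0 p k X) t0 _ _ NX sX sA).
- by move=> i; apply: nsq_ge0.
- by move=> i; apply: nsq_ge0.
move=> i; rewrite XE mulmxDl -scalemxAl; move: (A *m _) (B *m _) => x y.
have -> : nsq (x + (t%:C * u) *: y) =
    nsq x + sqn (t%:C * u) * nsq y + 2 * complex.Re (t%:C * u * inner y x).
  exact: nsq_addZ.
have -> : complex.Re (t%:C * u * inner y x) = t * complex.Re (u * inner y x).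
  by rewrite -mulrA; case: (u * _) => a b /=; rewrite mul0r subr0.
by rewrite sq; ring.
Qed.

Lemma dual_numerical_range_dir (u : C) : `|u| = 1 ->
  exists2 V : 'M[C]_(n, k), right_singular A V &
  - (N `^ (p - 1) * (eps * NB)) <= complex.Re (u * dualsum A p V B).
Proof.
move=> u1; have [F UF Foo] := exists_ultrafilter; have FF := @ultra_proper _ _ UF.
have kn' : (k <= n)%N by case/andP: kn.
have p20 : 0 <= (p - 2) / 2 by move: p2; lra.
pose tau (j : nat) : R := j.+1%:R^-1.
have tau0 : tau j @[j --> F] --> (0 : R) by apply: cvg_ultra_harmonic.
have ctau0 : ccvg F (fun j => (tau j)%:C * u) (0 * u).
  by apply: ccvgM => //; [apply: (ccvg_real FF tau0) | apply: ccvg_cst].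
pose X j := A + ((tau j)%:C * u) *: B.
(* Full bases are taken because [right_singular_cvg] compares partial sums of every length up to n;
   the first k columns are cut out afterwards. *)
have [E hE] := choice (fun j => right_singular_exists (X j) (leqnn n)).
have [E' EE'] : exists W, mxcvg F E W.
  by apply: ultra_mx => // t i j; apply: isometry_entry_le1; case: (hE t).
have XA : mxcvg F X A.
  have := mxcvgD FF (mxcvg_cst FF A) (mxcvgZ FF ctau0 (mxcvg_cst FF B)).
  by rewrite mul0r scale0r addr0.
have [RS sig] := right_singular_cvg UF XA hE EE'.
have VV' : mxcvg F (fun j => first_cols kn' (E j)) (first_cols kn' E').
  by move=> a b; rewrite mxE; under eq_fun do rewrite mxE; exact: EE'.
exists (first_cols kn' E'); first exact: right_singular_first_cols.
set V := first_cols kn' E' in VV' *.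
pose f j := \sum_(i < k) (sigma (X j) i ^+ 2) `^ ((p - 2) / 2) *
    (2 * complex.Re (u * inner (B *m col i (first_cols kn' (E j)))
                               (A *m col i (first_cols kn' (E j)))) +
     tau j * nsq (B *m col i (first_cols kn' (E j)))).
have fl : f j @[j --> F] --> \sum_(i < k) (sigma A i ^+ 2) `^ ((p - 2) / 2) *
    (2 * complex.Re (u * inner (B *m col i V) (A *m col i V)) +
     0 * nsq (B *m col i V)).
  apply: cvg_sumr => i; apply: cvgM.
    apply: cvg_powR => //; first by move=> j; apply: sqr_ge0.
    by apply: sig; exact: leq_trans (ltn_ord i) kn'.
  have BV (Y : 'M[C]_(m, n)) :
      mxcvg F (fun j => Y *m col i (first_cols kn' (E j))) (Y *m col i V).
    by apply: mxcvgM => //; [exact: mxcvg_cst | exact: mxcvg_col].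
  apply: cvgD; last by apply: cvgM => //; apply: cvg_nsq.
  apply: cvgMr; apply: ccvg_Re; apply: ccvgM => //; first exact: ccvg_cst.
  exact: ccvg_inner.
have -> : complex.Re (u * dualsum A p V B) =
  (\sum_(i < k) (sigma A i ^+ 2) `^ ((p - 2) / 2) *
    (2 * complex.Re (u * inner (B *m col i V) (A *m col i V)) +
     0 * nsq (B *m col i V))) / 2.
  rewrite /dualsum !mulr_sumr raddf_sum mulr_suml; apply: eq_bigr => i _ /=.
  rewrite sqr_powR_half ?sigma_ge0// mul0r addr0 mulrCA.
  by move: (_ `^ _) (u * _) => x [y z] /=; field.
rewrite ler_pdivlMr// mulrC mulrN; apply: ler_cvg_to (cvg_cst _) fl _.
apply: nearW => j; apply: perturbed_le => //; first by rewrite /tau invr_gt0.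
exact: right_singular_first_cols.
Qed.

(** Compactness in the form of a minimizing sequence. The squared modulus is polynomial in the real
    and imaginary parts, so it follows their limits. *)
Lemma dualsum_min : exists2 V : 'M[C]_(n, k), right_singular A V &
  forall V' : 'M[C]_(n, k), right_singular A V' ->
    sqn (dualsum A p V B) <= sqn (dualsum A p V' B).
Proof.
have [F UF Foo] := exists_ultrafilter; have FF := @ultra_proper _ _ UF.
have kn' : (k <= n)%N by case/andP: kn.
pose S : set R := [set sqn (dualsum A p V B) | V in right_singular (k := k) A].
have infS : has_inf S.
  split; last by exists 0 => _ [V _ <-]; apply: sqn_ge0.
  by have [V HV] := right_singular_exists A kn'; exists (sqn (dualsum A p V B)), V.
have step (j : nat) : exists V : 'M[C]_(n, k), right_singular A V /\
    sqn (dualsum A p V B) < inf S + j.+1%:R^-1.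
  have [|_ [V HV <-] h] := @inf_adherent _ S (j.+1%:R^-1) _ infS.
    by rewrite invr_gt0.
  by exists V.
have [V hV] := choice step.
have [W VW] : exists W, mxcvg F V W.
  by apply: (@right_singular_limit _ _ UF _ _ _ A) => j; case: (hV j).
exists W; first by apply: right_singular_closed VW => // j; case: (hV j).
move=> V' HV'; apply: (@le_trans _ _ (inf S)); last first.
  by apply: ge_inf; [case: infS | exists V'].
have [re im] := ccvg_dualsum UF A B p VW.
apply: (@ler_cvg_to _ F _ _ (fun j => sqn (dualsum A p (V j) B))
  (fun j => inf S + j.+1%:R^-1)).
- by rewrite /sqn !expr2; under eq_fun do rewrite !expr2; apply: cvgD; apply: cvgM.
- rewrite -[X in _ --> X]addr0; apply: cvgD; first exact: cvg_cst.
  exact: cvg_ultra_harmonic.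
- by apply: nearW => j; case: (hV j) => _ /ltW.
Qed.

Lemma sqn_addZ (a b : C) (t : R) :
  sqn (a + t%:C * b) = sqn a + 2 * t * complex.Re (Num.conj a * b) + t ^+ 2 * sqn b.
Proof. by case: a b => [a1 a2] [b1 b2]; rewrite /sqn /=; ring. Qed.

(** Absorbing the weights sigma_i^(p-2) into a power of A^*A turns [dualsum] into the trace of V^* M
    V with M independent of V. *)
Lemma dualsum_convex (V V' : 'M[C]_(n, k)) (t : R) :
  right_singular A V -> right_singular A V' -> 0 <= t <= 1 ->
  exists2 Z : 'M[C]_(n, k), right_singular A Z & dualsum A p Z B =
    (1 - t)%:C * dualsum A p V B + t%:C * dualsum A p V' B.
Proof.
move=> HV HV' t01; pose M := psd_pow (gram A) ((p - 2) / 2) *m (A ^t* *m B).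
have trE W : right_singular A W -> dualsum A p W B = \tr (W ^t* *m M *m W).
  move=> HW; rewrite -psd_sum_dualsum//; apply: eq_bigr => i _.
  by rewrite quadmxE.
have [Z [ZZ HZ trZ]] := numerical_range_convex M (gram_herm A) (adj_diag_real _)
  HV.1 HV'.1 HV.2 HV'.2 t01.
by exists Z => //; rewrite !trE.
Qed.

Lemma dualsum_small : exists2 V : 'M[C]_(n, k), right_singular A V &
  `|dualsum A p V B| <= (N `^ (p - 1) * (eps * NB))%:C.
Proof.
have [V HV Vmin] := dualsum_min; exists V => //.
set rho := _ * _; set w := dualsum A p V B in Vmin *; set r := complex.Re `|w|.
have r0 : 0 <= r by rewrite -ler0c normC_Re.
rewrite -normC_Re -/r lecR leNgt; apply/negP => rho_r.
have rho0 : 0 <= rho by rewrite !mulr_ge0 ?powR_ge0 ?kyfan_ge0.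
have rpos : 0 < r by apply: le_lt_trans rho_r.
have rw : `|w| = r%:C by rewrite /r normC_Re.
(* The direction opposite to w: it yields a point w1 of W with Re(conj(w) w1) <= r rho. *)
have [|V1 HV1] := @dual_numerical_range_dir (- Num.conj w / r%:C).
  rewrite normrM normrN norm_conjC rw normfV ger0_norm ?ler0c//.
  by rewrite mulfV// -[0]/((0 : R)%:C) (inj_eq (@complexI R)) gt_eqF.
rewrite -/rho; set w1 := dualsum A p V1 B => hdir.
pose c := complex.Re (Num.conj w * (w1 - w)); pose d := sqn (w1 - w).
have rr : r ^+ 2 = sqn w by apply: sqn_Re_norm.
(* Since r rho < r^2 = |w|^2, moving from w towards w1 initially decreases the modulus. *)
have c0 : c < 0.
  have -> : c = - r * complex.Re (- Num.conj w / r%:C * w1) - sqn w.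
    have -> : - Num.conj w / r%:C * w1 = (- r^-1)%:C * (Num.conj w * w1).
      by rewrite rmorphN fmorphV /=; ring.
    rewrite /c mulrBr conjM_sqn; move: (Num.conj w * w1) => [x y] /=.
    by field; rewrite gt_eqF.
  have hdir' := hdir; rewrite lerNl in hdir'; rewrite -rr.
  rewrite expr2 mulNr -opprD -mulrDr oppr_lt0 mulr_gt0// addrC -(opprK (complex.Re _)) subr_gt0.
  exact: le_lt_trans hdir' rho_r.
have d0 : 0 <= d by apply: sqn_ge0.
have dc : 0 < d - c by lra.
(* The quadratic 2 t c + t^2 d is least at -c/d, which may exceed 1 or be undefined. Enlarging the
   denominator by -c > 0 keeps t in (0, 1] and the value negative. *)
pose t := - c / (d - c).
have t0 : 0 < t by rewrite divr_gt0// oppr_gt0.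
have t1 : t <= 1 by rewrite ler_pdivrMr// mul1r; lra.
have [|Z HZ Zw] := @dualsum_convex V V1 t HV HV1; first by rewrite (ltW t0).
have := Vmin Z HZ; rewrite Zw -/w -/w1.
have -> : (1 - t)%:C * w + t%:C * w1 = w + t%:C * (w1 - w).
  by rewrite rmorphB /=; ring.
rewrite sqn_addZ -/c -/d -addrA lerDl.
have -> : 2 * t * c + t ^+ 2 * d = t * (c * (d - 2 * c) / (d - c)).
  by rewrite /t; field; rewrite gt_eqF.
rewrite pmulr_rge0// pmulr_lge0 ?invr_gt0// nmulr_rge0//; lra.
Qed.

End Necessity.

Theorem corollary2p11 (R : realType) (m n : nat) (A B : 'M[R[i]]_(m, n))
    (p : R) (k : nat) (eps : R)
    (hA : A != 0) (hp : 2 <= p) (hk1 : (1 <= k)%N) (hk : (k <= minn m n)%N)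
    (heps0 : 0 <= eps) (heps1 : eps < 1) :
  birkhoff_eps (kyfan p k) eps A B <->
  exists v : 'I_k -> 'cV[R[i]]_n,
    [/\ orthonormal_family v,
        forall i : 'I_k, gram A *m v i = ((sigma A i ^+ 2)%:C) *: v i
      & exists z0 : R[i],
          `|z0| <= 1 /\
          ((kyfan p k A `^ (p - 1))^-1)%:C
            * (\sum_(i < k)
                 inner (psd_pow (gram A) ((p - 2) / 2) *m (A ^t* *m B) *m v i)
                       (v i))
            + z0 * eps%:C * (kyfan p k B)%:C = 0].
Proof.
have kn : (0 < k <= n)%N by rewrite hk1 (leq_trans hk)// geq_minr.
have N0 : 0 < kyfan p k A `^ (p - 1) by apply/powR_gt0/kyfan_gt0.
split=> [hB|[v [ov hv [z0 [z01 hz]]]]].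
  have [V HV] := dualsum_small kn hp hA heps0 hB.
  rewrite -(psd_sum_dualsum p B HV); set w := \sum_(i < k) _ => hw.
  exists (fun i => col i V); split.
  - by move=> i j; rewrite isometry_inner ?HV.1// eq_sym.
  - by move=> i; apply: right_singular_col.
  move: N0 hw; rewrite -/w.
  move: (kyfan p k A `^ _) (kyfan_ge0 p k B) => x; move: (kyfan p k B) => y y0 x0 hw.
  have x0' : x%:C != 0 :> R[i] by rewrite -[0]/((0 : R)%:C) (inj_eq (@complexI R)) gt_eqF.
  (* In this degenerate case the bound forces w = 0; otherwise z0 is obtained by solving the
     equation. *)
  have [ey0|ey0] := eqVneq (eps * y) 0.
    exists 0; split; first by rewrite normr0.
    have /eqP-> : w == 0 by rewrite -normr_le0; move: hw; rewrite ey0 mulr0.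
    by rewrite !mul0r mulr0 addr0.
  have ey1 : 0 < x * (eps * y) by rewrite mulr_gt0// lt_neqAle eq_sym ey0 mulr_ge0.
  have ey1' : (x * (eps * y))%:C != 0 :> R[i].
    by rewrite -[0]/((0 : R)%:C) (inj_eq (@complexI R)) gt_eqF.
  exists (- w / (x * (eps * y))%:C); split.
    rewrite normrM normrN normfV [X in _ / X]ger0_norm ?ler0c ?(ltW ey1)//.
    by rewrite ler_pdivrMr ?mul1r// -[0]/((0 : R)%:C) ltcR.
  move: ey1'; rewrite fmorphV !rmorphM /= !mulf_eq0 !negb_or => /and3P[h1 h2 h3].
  by field; rewrite h1 h2 h3.
pose V : 'M[R[i]]_(n, k) := \matrix_(i, j) v j i 0.
have colV i : col i V = v i by apply/colP => j; rewrite !mxE.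
have HV : right_singular A V.
  split; apply/matrixP => i j.
    by rewrite adjmx_mulE !colV ov mxE eq_sym.
  have -> : (gram A *m V) i j = (gram A *m col j V) i 0.
    by rewrite [LHS]mxE [RHS]mxE; apply: eq_bigr => l _; rewrite [col _ _ _ _]mxE.
  by rewrite colV hv mul_mx_diag !mxE mulrC.
apply: (birkhoff_eps_dualsum kn hp hA heps0 HV).
rewrite -(psd_sum_dualsum p B HV); under eq_bigr do rewrite colV.
move: hz N0; set w := \sum_(i < k) _.
move: (kyfan p k A `^ _) (kyfan_ge0 p k B) => x; move: (kyfan p k B) => y y0 hz x0.
have x0' : x%:C != 0 :> R[i] by rewrite -[0]/((0 : R)%:C) (inj_eq (@complexI R)) gt_eqF.
(* Solving the equation for w turns |z0| <= 1 into the bound required by [birkhoff_eps_dualsum]. *)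
have -> : w = - (z0 * (x * (eps * y))%:C).
  move/eqP: hz; rewrite addr_eq0 fmorphV => /eqP hz.
  apply: (mulfI (invr_neq0 x0')); rewrite [LHS]hz !rmorphM /=.
  by field.
rewrite normrN normrM [X in _ * X]ger0_norm ?ler0c; last by rewrite !mulr_ge0// ltW.
by rewrite ler_piMl// ler0c !mulr_ge0// ltW.
Qed.
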